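(* Let $S_{n,k}$ be as defined (weights $a_j=1$), and let $n,k$ tend to infinity along sequences as indicated; convergence is in distribution. (1) If $n\to\infty$ and $k/\sqrt n\to0$, then $S_{n,k}\to0$. If $k\to\infty$ and $n/\sqrt k\to0$ (with $n\ge1$), then $S_{n,k}-k+n\to0$. (2) If $n,k\to\infty$ with $k/\sqrt n\to c>0$, then $S_{n,k}\to\mathrm{Po}(c^2)$. If $n,k\to\infty$ with $n/\sqrt k\to c>0$, then $S_{n,k}-k+n\to\mathrm{Po}(c^2)$. (3) If $n,k\to\infty$ with $k/\sqrt n\to\infty$ and $k/n^2\to0$, then $\frac{S_{n,k}-\mathbb E(S_{n,k})}{\sqrt{\mathbb V(S_{n,k})}}\to\mathcal N(0,1)$.
   Context: For $\vec\ell=(\ell_1,\dots,\ell_k)$ with $n\ge\ell_1\ge\cdots\ge\ell_k\ge1$ let $\sigma(\vec\ell)=|\{1\le j\le k-1:\ell_j=\ell_{j+1}\}|$. $S_{n,k}$ denotes the value of $\sigma$ on a uniformly random element of this set (uniform random $k$-multiset of $\{1,\dots,n\}$); equivalently $\mathbb P\{S_{n,k}=j\}=\binom{n}{k-j}\binom{k-1}{j}/\binom{n+k-1}{k}$. $\mathrm{Po}(\lambda)$ is the Poisson law with mean $\lambda$ and $\mathcal N(0,1)$ the standard normal law. *)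

(* Defs.v *)
From Stdlib Require Import Reals ZArith.
Open Scope R_scope.

Fixpoint binom (n k : nat) : nat :=
  match n, k with
  | _, O => 1%nat
  | O, S _ => 0%nat
  | S n', S k' => (binom n' k' + binom n' k)%nat
  end.

Definition pmf_S (n k j : nat) : R :=
  INR (binom n (k - j)) * INR (binom (k - 1) j) / INR (binom (n + k - 1) k).

(* S_{n,k} takes values in {0,..,k}; CDF of g(S_{n,k}) at x. *)
Definition cdf_of (n k : nat) (g : nat -> R) (x : R) : R :=
  sum_f_R0 (fun j => if Rle_dec (g j) x then pmf_S n k j else 0) k.

Definition mean_S (n k : nat) : R :=
  sum_f_R0 (fun j => INR j * pmf_S n k j) k.

Definition var_S (n k : nat) : R :=
  sum_f_R0 (fun j => (INR j - mean_S n k) ^ 2 * pmf_S n k j) k.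

Definition conv_in_dist (Fm : nat -> R -> R) (F : R -> R) : Prop :=
  forall x, continuity_pt F x -> Un_cv (fun m => Fm m x) (F x).

Definition cdf_dirac0 (x : R) : R := if Rle_dec 0 x then 1 else 0.

(* CDF of Po(lam): sum over nonnegative integers j <= x (all such j are < up x). *)
Definition cdf_poisson (lam x : R) : R :=
  sum_f_R0 (fun j => if Rle_dec (INR j) x then exp (- lam) * lam ^ j / INR (fact j) else 0)
           (Z.to_nat (up x)).

Definition std_normal_density (t : R) : R := exp (- (t ^ 2) / 2) / sqrt (2 * PI).

Definition is_std_normal_cdf_at (x l : R) : Prop :=
  forall eps, eps > 0 -> exists M0, forall M, M >= M0 ->
    forall pr : Riemann_integrable std_normal_density (- M) x,
      Rabs (RiemannInt pr - l) < eps.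

(* Main.v *)
Require Import Defs.
From Stdlib Require Import Reals ZArith Lra Lia Psatz.
From Coquelicot Require Import Coquelicot.
Open Scope R_scope.

(** The ratio of consecutive values of the probability mass function is explicit.

    Poisson regimes: the ratios converge to [c ^ 2 / (i + 1)], so the i-th probability is
    asymptotically [c ^ (2 i) / i!] times the probability of 0; since the means stay bounded no
    mass escapes, and total mass 1 forces the probability of 0 to tend to [exp (- c ^ 2)].
    The second half of (1) and (2) is the same argument with [n] and [k] exchanged, and (1) is
    the case [c = 0].

    Normal regime: the ratio formula summed against a test function is the Stein identity
    [E ((S - mu) g (S - 1)) = E (T (g S - g (S - 1)))] with [T = (k - S) (k - 1 - S) / N],
    [N = n + k - 1].  Here [E T] is the variance, and [T] is a quadratic polynomial in [S] whose
    relative fluctuations are [O (1 / sigma + 1 / N)].  Hence [E (f' W - W f W) -> 0] for the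
    standardised variable [W] and every C^1 function [f] with compactly supported derivative,
    that is [E (psi W) -> 0] for every continuous compactly supported [psi] with Gaussian mean 0.
    Sandwiching indicators between trapezoids gives convergence of the distribution functions. *)

(** * The hypergeometric law: ratios, moments and the Stein identity *)

Lemma binom_gt (n k : nat) : (n < k)%nat -> binom n k = 0%nat.
Proof.
revert k; induction n as [|n IH]; intros [|k] H; simpl; try lia.
rewrite !IH by lia; lia.
Qed.

Lemma binom_pos (n k : nat) : (k <= n)%nat -> (0 < binom n k)%nat.
Proof.
revert k; induction n as [|n IH]; intros [|k] H; simpl; try lia.
assert (H1 := IH k ltac:(lia)); lia.
Qed.

Lemma binom_0_r (n : nat) : binom n 0 = 1%nat.
Proof. now destruct n. Qed.

(** The difference is taken in [R], which makes the identity total: for [k > n] both binomials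
    vanish, and for [k = n] both sides are 0. *)
Lemma binom_absorb (n k : nat) :
  INR (binom n (S k)) * (INR k + 1) = INR (binom n k) * (INR n - INR k).
Proof.
revert k; induction n as [|n IH]; intros k.
- destruct k; simpl; ring.
- destruct k as [|k].
  + assert (H := IH 0%nat); rewrite binom_0_r in *.
    change (binom (S n) 1) with (binom n 0 + binom n 1)%nat.
    rewrite binom_0_r, plus_INR, (S_INR n); change (INR 1) with 1 in *; change (INR 0) with 0 in *.
    rewrite !Rplus_0_l, !Rmult_1_r, !Rminus_0_r in *; rewrite H; ring.
  + assert (H1 := IH (S k)); assert (H0 := IH k).
    change (binom (S n) (S (S k))) with (binom n (S k) + binom n (S (S k)))%nat.
    change (binom (S n) (S k)) with (binom n k + binom n (S k))%nat.
    rewrite !plus_INR, !S_INR in *; nra.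
Qed.

Lemma sum_f_R0_first (f : nat -> R) (n : nat) :
  sum_f_R0 f (S n) = f 0%nat + sum_f_R0 (fun j => f (S j)) n.
Proof. rewrite decomp_sum by lia; reflexivity. Qed.

Lemma sum_f_R0_0 (f : nat -> R) (n : nat) :
  (forall j, (j <= n)%nat -> f j = 0) -> sum_f_R0 f n = 0.
Proof. intros H; rewrite (sum_eq _ (fun _ => 0)) by auto; rewrite sum_cte; ring. Qed.

Lemma sum_f_R0_lin (a b : R) (f g : nat -> R) (n : nat) :
  sum_f_R0 (fun j => a * f j + b * g j) n = a * sum_f_R0 f n + b * sum_f_R0 g n.
Proof. induction n as [|n IH]; simpl; [ring|rewrite IH; ring]. Qed.

(** Induction on [m]: Pascal's rule for [binom (S m) (S j)] splits the sum into the instances for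
    [k] and [S k]. *)
Lemma vandermonde (n m k : nat) :
  sum_f_R0 (fun j => INR (binom n (k - j)) * INR (binom m j)) k = INR (binom (n + m) k).
Proof.
revert k; induction m as [|m IH]; intros k.
- rewrite Nat.add_0_r; destruct k as [|k].
  + simpl; rewrite binom_0_r; simpl; ring.
  + rewrite sum_f_R0_first, sum_f_R0_0; [|intros; simpl; ring].
    rewrite binom_0_r, Nat.sub_0_r; simpl INR; ring.
- destruct k as [|k].
  + simpl; rewrite !binom_0_r; simpl; ring.
  + rewrite Nat.add_succ_r.
    change (binom (S (n + m)) (S k)) with (binom (n + m) k + binom (n + m) (S k))%nat.
    rewrite plus_INR, <- !IH, !sum_f_R0_first, !binom_0_r.
    rewrite (sum_eq _ (fun j => 1 * (INR (binom n (k - j)) * INR (binom m j))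
       + 1 * (INR (binom n (S k - S j)) * INR (binom m (S j))))).
    * rewrite sum_f_R0_lin; ring.
    * intros j _; simpl; rewrite plus_INR; ring.
Qed.

(** * Expectations for weights on an initial segment *)

Definition expect (p : nat -> R) (K : nat) (g : nat -> R) : R :=
  sum_f_R0 (fun j => p j * g j) K.

Lemma expect_ext (p : nat -> R) (K : nat) (g h : nat -> R) :
  (forall j, (j <= K)%nat -> g j = h j) -> expect p K g = expect p K h.
Proof. intros H; apply sum_eq; intros j Hj; now rewrite H. Qed.

Lemma expect_lin (p : nat -> R) (K : nat) (a b : R) (g h : nat -> R) :
  expect p K (fun j => a * g j + b * h j) = a * expect p K g + b * expect p K h.
Proof. unfold expect; rewrite <- sum_f_R0_lin; apply sum_eq; intros; ring. Qed.

Lemma expect_le (p : nat -> R) (K : nat) (g h : nat -> R) :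
  (forall j, 0 <= p j) -> (forall j, (j <= K)%nat -> g j <= h j) ->
  expect p K g <= expect p K h.
Proof. intros Hp H; apply sum_Rle; intros j Hj; apply Rmult_le_compat_l; auto. Qed.

Lemma expect_abs (p : nat -> R) (K : nat) (g : nat -> R) :
  (forall j, 0 <= p j) -> Rabs (expect p K g) <= expect p K (fun j => Rabs (g j)).
Proof.
intros Hp; apply Rle_trans with (1 := Rsum_abs _ _); apply Req_le, sum_eq.
intros j _; rewrite Rabs_mult, (Rabs_pos_eq (p j)); auto.
Qed.

Lemma expect_const (p : nat -> R) (K : nat) (a : R) :
  sum_f_R0 p K = 1 -> expect p K (fun _ => a) = a.
Proof. intros H; unfold expect; rewrite <- scal_sum, H; ring. Qed.

Lemma pmf_S_ge0 (n k j : nat) : 0 <= pmf_S n k j.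
Proof.
unfold pmf_S, Rdiv; apply Rmult_le_pos.
- apply Rmult_le_pos; apply pos_INR.
- destruct (Rle_lt_or_eq_dec _ _ (pos_INR (binom (n + k - 1) k))) as [H|H].
  + now apply Rlt_le, Rinv_0_lt_compat.
  (* A vanishing denominator is harmless, since [/ 0] is 0. *)
  + rewrite <- H, Rinv_0; lra.
Qed.

Lemma pmf_S_sum (n k : nat) : (1 <= n)%nat -> sum_f_R0 (pmf_S n k) k = 1.
Proof.
intros Hn.
assert (H0 : 0 < INR (binom (n + k - 1) k)) by (apply lt_0_INR, binom_pos; lia).
unfold pmf_S, Rdiv.
rewrite <- scal_sum with (x := / INR (binom (n + k - 1) k)) (An := fun j => INR (binom n (k - j)) * INR (binom (k - 1) j)).
(* The case [k = 0] is separate: truncated subtraction makes [n + (k - 1)] and [n + k - 1] differ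
   there. *)
rewrite vandermonde; destruct k as [|k].
- rewrite !binom_0_r; simpl; field.
- replace (n + (S k - 1))%nat with (n + S k - 1)%nat by lia; field; lra.
Qed.

Lemma pmf_S_gt (n k j : nat) : (k < j)%nat -> pmf_S n k j = 0.
Proof. intros H; unfold pmf_S; rewrite (binom_gt (k - 1)) by lia; simpl; unfold Rdiv; ring. Qed.

(** Absorption in each of the two binomials. No division appears because [n - k + j + 1] can be zero
    or negative when [k > n]; for [j >= k] both sides vanish. *)
Lemma pmf_S_rec (n k j : nat) :
  pmf_S n k (S j) * ((INR j + 1) * (INR n - INR k + INR j + 1)) =
  pmf_S n k j * ((INR k - 1 - INR j) * (INR k - INR j)).
Proof.
destruct (Nat.lt_ge_cases j k) as [H|H].
- unfold pmf_S, Rdiv; generalize (/ INR (binom (n + k - 1) k)) (binom_absorb (k - 1) j)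
    (binom_absorb n (k - S j)).
  replace (S (k - S j)) with (k - j)%nat by lia.
  rewrite !minus_INR, (S_INR j) by lia; change (INR 1) with 1; intros z A B.
  transitivity (INR (binom n (k - S j)) * (INR n - (INR k - (INR j + 1)))
    * (INR (binom (k - 1) (S j)) * (INR j + 1)) * z); [ring|].
  rewrite A, <- B; ring.
- rewrite pmf_S_gt by lia.
  destruct (Nat.eq_dec j k) as [->|H']; [ring|rewrite pmf_S_gt by lia; ring].
Qed.

(** The recursion is multiplied by [g (INR j)] and summed, with the index shifted by one. The
    boundary terms vanish through the factors [k - j] at [j = k] and [j] at [j = 0]. *)
Lemma pmf_S_stein_raw (n k : nat) (g : R -> R) :
  expect (pmf_S n k) k (fun j => (INR k - 1 - INR j) * (INR k - INR j) * g (INR j)) =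
  expect (pmf_S n k) k (fun j => INR j * (INR n - INR k + INR j) * g (INR j - 1)).
Proof.
unfold expect; destruct k as [|k]; [simpl; ring|].
rewrite tech5, sum_f_R0_first.
rewrite (sum_eq _ (fun j => pmf_S n (S k) (S j) *
   (INR (S j) * (INR n - INR (S k) + INR (S j)) * g (INR (S j) - 1)))).
- simpl (INR 0); ring.
- intros j _; rewrite (S_INR j), <- !Rmult_assoc.
  replace (INR j + 1 - 1) with (INR j) by ring; f_equal.
  generalize (pmf_S_rec n (S k) j); intros H; lra.
Qed.

Lemma mean_S_expect (n k : nat) : mean_S n k = expect (pmf_S n k) k INR.
Proof. apply sum_eq; intros; ring. Qed.

(** With [g = 1] the quadratic terms of the raw identity cancel, which leaves a linear equation for
    the mean. *)
Lemma mean_S_eq (n k : nat) : (1 <= n)%nat ->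
  (INR n + INR k - 1) * mean_S n k = INR k * (INR k - 1).
Proof.
intros Hn; generalize (pmf_S_stein_raw n k (fun _ => 1)); intros H.
assert (E : expect (pmf_S n k) k (fun j => 1 * (INR j * (INR n - INR k + INR j) * 1)
   + (-1) * ((INR k - 1 - INR j) * (INR k - INR j) * 1)) = 0) by (rewrite expect_lin; lra).
rewrite (expect_ext _ _ _ (fun j => (INR n + INR k - 1) * INR j + (- (INR k * (INR k - 1))) * 1)) in E
  by (intros; ring).
rewrite (expect_lin _ _ _ _ INR (fun _ => 1)), expect_const, <- mean_S_expect in E by now apply pmf_S_sum.
lra.
Qed.

(** [E ((k - S) (k - 1 - S) g (S - 1))] is subtracted from both sides of the raw identity; the
    remaining weight of [g (S - 1)] is linear, namely [(n + k - 1) (S - mu)]. *)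
Lemma pmf_S_stein (n k : nat) (g : R -> R) : (1 <= n)%nat ->
  (INR n + INR k - 1) * expect (pmf_S n k) k (fun j => (INR j - mean_S n k) * g (INR j - 1)) =
  expect (pmf_S n k) k (fun j => (INR k - INR j) * (INR k - 1 - INR j) * (g (INR j) - g (INR j - 1))).
Proof.
intros Hn; generalize (pmf_S_stein_raw n k g) (mean_S_eq n k Hn); intros H Hm.
rewrite (expect_ext _ _ (fun j => (INR k - INR j) * (INR k - 1 - INR j) * _)
   (fun j => 1 * ((INR k - 1 - INR j) * (INR k - INR j) * g (INR j))
     + (-1) * ((INR k - 1 - INR j) * (INR k - INR j) * g (INR j - 1)))) by (intros; ring).
rewrite expect_lin, H, <- expect_lin.
(* A null term is added so that [expect_lin] can take the factor [n + k - 1] inside the sum. *)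
rewrite <- (Rplus_0_r (_ * expect _ _ _)).
rewrite <- (Rmult_0_l (expect (pmf_S n k) k (fun _ => 0))), <- expect_lin.
apply expect_ext; intros j _.
transitivity (((INR n + INR k - 1) * INR j - (INR n + INR k - 1) * mean_S n k) * g (INR j - 1)); [ring|].
rewrite Hm; ring.
Qed.

Lemma var_S_expect (n k : nat) :
  var_S n k = expect (pmf_S n k) k (fun j => (INR j - mean_S n k) ^ 2).
Proof. apply sum_eq; intros; ring. Qed.

(** The Stein identity for [g] the identity: the increment of [g] is 1, and the shift in [g (S - 1)]
    contributes only a multiple of [E (S - mu) = 0]. *)
Lemma var_S_stein (n k : nat) : (1 <= n)%nat ->
  (INR n + INR k - 1) * var_S n k =
  expect (pmf_S n k) k (fun j => (INR k - INR j) * (INR k - 1 - INR j)).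
Proof.
intros Hn; generalize (pmf_S_stein n k (fun s => s) Hn); intros H.
rewrite (expect_ext _ _ (fun j => (INR k - INR j) * (INR k - 1 - INR j) * (INR j - (INR j - 1)))
   (fun j => (INR k - INR j) * (INR k - 1 - INR j))) in H by (intros; ring).
rewrite <- H, var_S_expect; f_equal.
rewrite (expect_ext _ _ (fun j => (INR j - mean_S n k) * (INR j - 1))
  (fun j => 1 * ((INR j - mean_S n k) ^ 2) + (mean_S n k - 1) * (1 * INR j + (- mean_S n k) * 1))).
- rewrite (expect_lin _ _ 1), (expect_lin _ _ 1 _ INR (fun _ => 1)), <- mean_S_expect, expect_const
    by now apply pmf_S_sum.
  ring.
- intros; ring.
Qed.

(** The mean of [(k - S) (k - 1 - S)] is its value at [mu] plus the variance, so the preceding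
    identity can be solved for the variance. *)
Lemma var_S_quad (n k : nat) : (1 <= n)%nat ->
  (INR n + INR k - 2) * var_S n k = (INR k - mean_S n k) * (INR k - 1 - mean_S n k).
Proof.
intros Hn; generalize (var_S_stein n k Hn); intros Hv.
rewrite (expect_ext _ _ _ (fun j => 1 * ((INR j - mean_S n k) ^ 2) +
   1 * ((2 * mean_S n k - 2 * INR k + 1) * INR j + (INR k * (INR k - 1) - mean_S n k ^ 2) * 1))) in Hv
  by (intros; ring).
rewrite (expect_lin _ _ 1), (expect_lin _ _ _ _ INR (fun _ => 1)), <- mean_S_expect, <- var_S_expect,
  expect_const in Hv by now apply pmf_S_sum.
lra.
Qed.

Lemma mean_S_compl (n k : nat) : (1 <= n)%nat ->
  (INR n + INR k - 1) * (INR k - mean_S n k) = INR k * INR n /\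
  (INR n + INR k - 1) * (INR k - 1 - mean_S n k) = (INR k - 1) * (INR n - 1).
Proof. intros Hn; generalize (mean_S_eq n k Hn); lra. Qed.

(** With [N = n + k - 1] the variance is [k n (k - 1) (n - 1) / (N ^ 2 (N - 1))], hence at least
    [(k n) ^ 2 / (4 N ^ 3)]. As [N] is at most twice the larger of [n] and [k], the constant is
    [4 * 8 = 32]. *)
Lemma var_S_ge (n k : nat) (V : R) : (2 <= n)%nat -> (2 <= k)%nat ->
  32 * V * INR n <= INR k ^ 2 -> 32 * V * INR k <= INR n ^ 2 -> V <= var_S n k.
Proof.
intros Hn Hk H1 H2.
generalize (var_S_quad n k ltac:(lia)) (mean_S_compl n k ltac:(lia)).
apply le_INR in Hn, Hk; simpl in Hn, Hk.
generalize (INR n) (INR k) (mean_S n k) (var_S n k) Hn Hk H1 H2; clear.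
intros n k mu v Hn Hk H1 H2 Hv [Ha Hb].
set (N := n + k - 1) in *.
assert (HN : 3 <= N) by (unfold N; lra).
destruct (Rle_lt_dec V v) as [H|H]; [assumption|exfalso].
assert (E : N ^ 2 * ((N - 1) * v) = k * n * ((k - 1) * (n - 1))).
{ rewrite <- Ha, <- Hb; replace (N - 1) with (n + k - 2) by (unfold N; ring); rewrite Hv; ring. }
assert (E1 : k * n * (k * n) <= 4 * (N ^ 2 * ((N - 1) * v))).
{ rewrite E; assert (k * n <= 4 * ((k - 1) * (n - 1))) by nra.
  assert (0 < k * n) by nra; nra. }
assert (Hv0 : 0 < v).
{ apply Rmult_lt_reg_l with (N ^ 2 * (N - 1)); [nra|].
  rewrite Rmult_0_r, Rmult_assoc, E; apply Rmult_lt_0_compat; nra. }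
assert (E2 : N ^ 2 * ((N - 1) * v) < N ^ 2 * (N * V)).
{ apply Rmult_lt_compat_l; [nra|].
  nra. }
assert (HV : 0 < V) by lra.
destruct (Rle_lt_dec k n) as [C|C].
- assert (N ^ 2 * (N * V) <= 8 * n ^ 2 * (n * V)).
  { assert (N <= 2 * n) by (unfold N; lra).
    assert (N ^ 2 <= 4 * n ^ 2) by nra.
    assert (N * V <= 2 * (n * V)) by nra.
    apply Rle_trans with (4 * n ^ 2 * (2 * (n * V))); [|lra].
    apply Rmult_le_compat; nra. }
  assert (n ^ 2 * (32 * V * n) <= n ^ 2 * k ^ 2) by (apply Rmult_le_compat_l; nra).
  nra.
- assert (N ^ 2 * (N * V) <= 8 * k ^ 2 * (k * V)).
  { assert (N <= 2 * k) by (unfold N; lra).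
    assert (N ^ 2 <= 4 * k ^ 2) by nra.
    assert (N * V <= 2 * (k * V)) by nra.
    apply Rle_trans with (4 * k ^ 2 * (2 * (k * V))); [|lra].
    apply Rmult_le_compat; nra. }
  assert (k ^ 2 * (32 * V * k) <= k ^ 2 * n ^ 2) by (apply Rmult_le_compat_l; nra).
  nra.
Qed.

(** * Poisson limits *)

Lemma sum_f_R0_trunc (f : nat -> R) (a b : nat) :
  (forall j, (a < j)%nat -> (j <= b)%nat -> f j = 0) -> (a <= b)%nat ->
  sum_f_R0 f b = sum_f_R0 f a.
Proof.
intros H Hab; induction Hab as [|b Hab IH]; [reflexivity|].
simpl; rewrite IH by auto; rewrite H by lia; ring.
Qed.

Lemma sum_f_R0_trunc2 (f : nat -> R) (a b : nat) :
  (forall j, (a < j)%nat -> f j = 0) -> (forall j, (b < j)%nat -> f j = 0) ->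
  sum_f_R0 f a = sum_f_R0 f b.
Proof.
intros Ha Hb; destruct (Nat.le_ge_cases a b) as [H|H].
- symmetry; apply sum_f_R0_trunc; auto.
- apply sum_f_R0_trunc; auto.
Qed.

Lemma is_lim_seq_sum_f_R0 (f : nat -> nat -> R) (l : nat -> R) (J : nat) :
  (forall j, is_lim_seq (fun m => f m j) (l j)) ->
  is_lim_seq (fun m => sum_f_R0 (f m) J) (sum_f_R0 l J).
Proof.
intros H; induction J as [|J IH]; simpl; auto.
apply is_lim_seq_plus'; auto.
Qed.

Lemma exp_series (L : R) :
  is_lim_seq (fun I => sum_f_R0 (fun i => L ^ i / INR (fact i)) I) (exp L).
Proof.
generalize (proj1 (is_pseries_R _ _ _) (is_exp_Reals L)); intros H.
apply is_lim_seq_ext with (2 := H).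
intros I; rewrite sum_n_Reals; apply sum_eq; intros; unfold Rdiv; ring.
Qed.

Lemma eventually_gt (f : nat -> R) (B : R) : is_lim_seq f p_infty -> eventually (fun m => B < f m).
Proof. intros H; exact (proj2 (is_lim_seq_spec _ p_infty) H B). Qed.

Lemma eventually_near (f : nat -> R) (l eps : R) : is_lim_seq f l -> 0 < eps ->
  eventually (fun m => Rabs (f m - l) < eps).
Proof. intros H He; exact (proj2 (is_lim_seq_spec _ (Finite l)) H (mkposreal eps He)). Qed.

Lemma cv_infty_lim (f : nat -> R) : cv_infty f -> is_lim_seq f p_infty.
Proof. intros H; apply is_lim_seq_spec; intros M; exact (H M). Qed.

Lemma is_lim_seq_sqrt_INR (v : nat -> nat) :
  is_lim_seq (fun m => INR (v m)) p_infty -> is_lim_seq (fun m => sqrt (INR (v m))) p_infty.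
Proof. intros H; exact (filterlim_comp _ _ _ _ _ _ _ _ H filterlim_sqrt_p). Qed.

(** In the Poisson regime [u <= v] keeps the denominators of the ratios positive, and the quadratic
    bound keeps the means bounded. *)
Lemma eventually_sqrt_ratio_le (u v : nat -> nat) (c : R) : 0 <= c ->
  is_lim_seq (fun m => INR (v m)) p_infty ->
  is_lim_seq (fun m => INR (u m) / sqrt (INR (v m))) c ->
  eventually (fun m => 2 <= INR (v m) /\ (u m <= v m)%nat /\ INR (u m) ^ 2 <= (c + 1) ^ 2 * INR (v m)).
Proof.
intros Hc Hv Hu.
generalize (filter_and _ _ (eventually_near _ _ 1 Hu Rlt_0_1)
  (filter_and _ _ (eventually_gt _ 2 Hv) (eventually_gt _ (c + 1) (is_lim_seq_sqrt_INR _ Hv)))).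
apply filter_imp; intros m (H1 & H2 & H3).
set (s := sqrt (INR (v m))) in *.
assert (Hs : s * s = INR (v m)) by (apply sqrt_sqrt, pos_INR).
assert (H4 : INR (u m) <= (c + 1) * s).
{ apply Rabs_lt_between in H1.
  replace (INR (u m)) with (INR (u m) / s * s) by (field; lra).
  apply Rmult_le_compat_r; lra. }
generalize (pos_INR (u m)); intros H5; repeat split.
- lra.
(* [u <= (c + 1) s <= s ^ 2 = v], the second step by the threshold [c + 1 < s]. *)
- apply INR_le; rewrite <- Hs; nra.
- rewrite <- Hs; nra.
Qed.

(** Markov's inequality for the event [j >= I + 1]. The cut-off [I] may exceed [K], where the
    weights vanish. *)
Lemma markov_head (p : nat -> R) (K I : nat) :
  (forall j, 0 <= p j) -> (forall j, (K < j)%nat -> p j = 0) -> sum_f_R0 p K = 1 ->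
  1 - expect p K INR / (INR I + 1) <= sum_f_R0 p I.
Proof.
intros Hp HK H1.
assert (HI := pos_INR I).
set (q := fun j => if Compare_dec.le_dec j I then p j else 0).
replace (sum_f_R0 p I) with (sum_f_R0 q K).
(* Pointwise, the indicator of [j <= I] is at least [1 - j / (I + 1)]. *)
- replace (1 - _) with (expect p K (fun j => 1 * 1 + (- / (INR I + 1)) * INR j)).
  + apply sum_Rle; intros j _; unfold q; destruct (Compare_dec.le_dec j I) as [Hj|Hj].
    * assert (0 <= / (INR I + 1) * INR j).
      { apply Rmult_le_pos; [apply Rlt_le, Rinv_0_lt_compat; lra|apply pos_INR]. }
      generalize (Hp j); nra.
    * assert (Hj' : (I + 1 <= j)%nat) by lia; apply le_INR in Hj'; rewrite plus_INR in Hj'.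
      simpl in Hj'.
      assert (1 <= / (INR I + 1) * INR j).
      { apply Rmult_le_reg_l with (INR I + 1); [lra|]; field_simplify; lra. }
      generalize (Hp j); nra.
  + rewrite (expect_lin _ _ 1 _ (fun _ => 1) INR), expect_const by assumption.
    unfold Rdiv; ring.
- rewrite (sum_f_R0_trunc2 q K I).
  + apply sum_eq; intros j Hj; unfold q; destruct (Compare_dec.le_dec j I); auto; lia.
  + intros j Hj; unfold q; destruct (Compare_dec.le_dec j I); auto.
  + intros j Hj; unfold q; destruct (Compare_dec.le_dec j I); auto; lia.
Qed.

(** The product of [rho 0] up to [rho (i - 1)]: the quotient of the weights of [i] and 0 when [rho]
    lists consecutive ratios. *)
Fixpoint iter_ratio (rho : nat -> R) (i : nat) : R :=
  match i with O => 1 | S i' => iter_ratio rho i' * rho i' end.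

Lemma is_lim_seq_iter_ratio (rho : nat -> nat -> R) (L : R) :
  (forall i, is_lim_seq (fun m => rho m i) (L / (INR i + 1))) ->
  forall i, is_lim_seq (fun m => iter_ratio (rho m) i) (L ^ i / INR (fact i)).
Proof.
intros H; induction i as [|i IH]; simpl iter_ratio.
- simpl; replace (1 / 1) with 1 by field; apply is_lim_seq_const.
- replace (L ^ S i / INR (fact (S i))) with (L ^ i / INR (fact i) * (L / (INR i + 1))).
  + now apply is_lim_seq_mult'.
  + rewrite fact_simpl, mult_INR, S_INR; simpl pow; field.
    generalize (pos_INR i) (INR_fact_lt_0 i); lra.
Qed.

(* Tightness (a bounded mean) forces the normalisation [p 0 -> exp (- L)], so no
   asymptotics of the binomial coefficients are needed. *)
Lemma ratio_limit_poisson (P : nat -> nat -> R) (K : nat -> nat) (rho : nat -> nat -> R) (L B : R) :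
  0 <= L ->
  (forall m i, 0 <= P m i) ->
  (forall m i, (K m < i)%nat -> P m i = 0) ->
  eventually (fun m => sum_f_R0 (P m) (K m) = 1) ->
  eventually (fun m => expect (P m) (K m) INR <= B) ->
  eventually (fun m => forall i, P m (S i) = P m i * rho m i) ->
  (forall i, is_lim_seq (fun m => rho m i) (L / (INR i + 1))) ->
  forall i, is_lim_seq (fun m => P m i) (exp (- L) * L ^ i / INR (fact i)).
Proof.
intros HL HP HK H1 HB Hrho Hlim.
assert (HR := is_lim_seq_iter_ratio rho L Hlim).
assert (HPR : eventually (fun m => forall i, P m i = P m 0%nat * iter_ratio (rho m) i)).
{ revert Hrho; apply filter_imp; intros m H; induction i as [|i IH]; simpl; [ring|].
  rewrite H, IH; ring. }
assert (HeL : 1 <= exp L) by (rewrite <- exp_0; destruct HL as [HL|<-]; [left; now apply exp_increasing|right; reflexivity]).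
assert (H0 : is_lim_seq (fun m => P m 0%nat) (exp (- L))).
{ apply is_lim_seq_spec; intros [e He]; simpl.
  assert (He4 : 0 < e / 4) by lra.
  (* [I] is chosen so that the Markov tail and the remainder of the exponential series are both
     below [e / 4]. *)
  assert (HBI : eventually (fun I => B / (INR I + 1) < e / 4)).
  { assert (T : is_lim_seq (fun I => B * / (INR I + 1)) (B * 0)).
    { apply is_lim_seq_mult'; [apply is_lim_seq_const|].
      apply (is_lim_seq_inv _ p_infty); try easy.
      apply (is_lim_seq_plus _ _ p_infty 1 p_infty); try easy; [apply is_lim_seq_INR|apply is_lim_seq_const]. }
    generalize (eventually_near _ _ (e / 4) T He4); apply filter_imp; intros I HI.
    apply Rabs_lt_between in HI; unfold Rdiv; lra. }
  destruct (filter_and _ _ HBI (eventually_near _ _ (e / 4) (exp_series L) He4)) as [I HI].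
  destruct (HI I (le_n _)) as [HI1 HI2]; clear HI HBI.
  set (E := sum_f_R0 (fun i => L ^ i / INR (fact i)) I) in *.
  assert (HS := is_lim_seq_sum_f_R0 _ _ I HR).
  generalize (filter_and _ _ (eventually_near _ _ (e / 4) HS He4)
     (filter_and _ _ H1 (filter_and _ _ HB HPR))).
  apply filter_imp; intros m (G1 & G2 & G3 & G4).
  fold E in G1; set (A := sum_f_R0 (iter_ratio (rho m)) I) in *.
  set (s := P m 0%nat) in *.
  assert (Hs0 : 0 <= s) by apply HP.
  assert (Hle : forall J, sum_f_R0 (P m) J <= 1).
  { intros J; destruct (Nat.le_ge_cases J (K m)) as [HJ|HJ].
    - rewrite <- G2; clear -HJ HP; induction HJ; [lra|]; simpl; generalize (HP m (S m0)); lra.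
    - rewrite (sum_f_R0_trunc2 (P m) J (K m)); try lra; intros; apply HK; lia. }
  assert (Hs1 : s <= 1) by (apply (Hle 0%nat)).
  assert (HsA : sum_f_R0 (P m) I = s * A).
  { unfold A; rewrite scal_sum; apply sum_eq; intros; rewrite G4; fold s; ring. }
  assert (Hlow := markov_head (P m) (K m) I (HP m) (HK m) G2).
  assert (Hup := Hle I); rewrite HsA in Hlow, Hup.
  assert (expect (P m) (K m) INR / (INR I + 1) <= B / (INR I + 1)).
  { apply Rmult_le_compat_r; [|assumption].
    apply Rlt_le, Rinv_0_lt_compat; generalize (pos_INR I); lra. }
  (* [s * A] lies between [1 - e / 4] and 1, and replacing [A] by [exp L] costs at most [e / 2]
     because [s <= 1]. *)
  assert (Hfin : Rabs (s * exp L - 1) < e).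
  { apply Rabs_lt_between in G1; apply Rabs_lt_between in HI2; apply Rabs_lt_between.
    assert (Rabs (s * (exp L - A)) <= e / 2).
    { rewrite Rabs_mult, (Rabs_pos_eq s) by assumption.
      assert (Rabs (exp L - A) <= e / 2) by (apply Rabs_le; lra).
      generalize (Rabs_pos (exp L - A)); nra. }
    apply Rabs_le_between in H0; lra. }
  replace (s - exp (- L)) with (exp (- L) * (s * exp L - 1)).
  - rewrite Rabs_mult, exp_Ropp, (Rabs_pos_eq (/ exp L)) by (apply Rlt_le, Rinv_0_lt_compat; lra).
    assert (/ exp L <= 1) by (rewrite <- Rinv_1; apply Rinv_le_contravar; lra).
    generalize (Rabs_pos (s * exp L - 1)); nra.
  - rewrite exp_Ropp; field; lra. }
intros i; apply is_lim_seq_ext_loc with (fun m => P m 0%nat * iter_ratio (rho m) i).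
- revert HPR; apply filter_imp; intros m H; now rewrite (H i).
- replace (exp (- L) * L ^ i / INR (fact i)) with (exp (- L) * (L ^ i / INR (fact i))) by (unfold Rdiv; ring).
  now apply is_lim_seq_mult'.
Qed.

(** Ensures that cutting a sum at [Z.to_nat (up x)] loses no index [j <= x]; for negative [x] the
    cut-off is 0. *)
Lemma up_nat_lt (x : R) (j : nat) : (Z.to_nat (up x) < j)%nat -> x < INR j.
Proof.
intros H; destruct (archimed x) as [H1 _].
apply Rlt_le_trans with (1 := H1); rewrite INR_IZR_INZ; apply IZR_le; lia.
Qed.

(** The summand vanishes beyond [K m] by support and beyond [up x] by the indicator, so the moving
    range is exchanged for a fixed one and the limit is taken term by term. *)
Lemma poisson_cdf_limit (P : nat -> nat -> R) (K : nat -> nat) (L : R) :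
  (forall m i, (K m < i)%nat -> P m i = 0) ->
  (forall i, is_lim_seq (fun m => P m i) (exp (- L) * L ^ i / INR (fact i))) ->
  forall x, is_lim_seq (fun m => sum_f_R0 (fun j => if Rle_dec (INR j) x then P m j else 0) (K m))
    (cdf_poisson L x).
Proof.
intros HK H x.
apply is_lim_seq_ext with
  (fun m => sum_f_R0 (fun j => if Rle_dec (INR j) x then P m j else 0) (Z.to_nat (up x))).
- intros m; apply sum_f_R0_trunc2; intros j Hj; destruct (Rle_dec (INR j) x); auto.
  apply up_nat_lt in Hj; lra.
- apply (is_lim_seq_sum_f_R0 (fun m j => if Rle_dec (INR j) x then P m j else 0)).
  intros j; destruct (Rle_dec (INR j) x); [apply H|apply is_lim_seq_const].
Qed.

Lemma ratio_limit (u v : nat -> nat) (c : R) (i : nat) :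
  is_lim_seq (fun m => INR (v m)) p_infty ->
  is_lim_seq (fun m => INR (u m) / sqrt (INR (v m))) c ->
  is_lim_seq (fun m => (INR (u m) - 1 - INR i) * (INR (u m) - INR i) /
     ((INR i + 1) * (INR (v m) - INR (u m) + INR i + 1))) (c ^ 2 / (INR i + 1)).
Proof.
intros Hv Hu.
assert (Hi := pos_INR i).
assert (Hs := is_lim_seq_sqrt_INR _ Hv).
assert (Hr : is_lim_seq (fun m => / sqrt (INR (v m))) 0).
{ apply (is_lim_seq_inv _ p_infty); easy. }
(* After division by [v], numerator and denominator are polynomials in [a], which tends to [c], and
   [r], which tends to 0. *)
set (a := fun m => INR (u m) / sqrt (INR (v m))) in *.
set (r := fun m => / sqrt (INR (v m))) in *.
apply is_lim_seq_ext_loc with (fun m => (a m - (1 + INR i) * r m) * (a m - INR i * r m) *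
  / ((INR i + 1) * (1 - a m * r m + (INR i + 1) * (r m * r m)))).
- generalize (filter_and _ _ (eventually_gt _ 0 Hs) (eventually_gt _ 0 Hv)).
  apply filter_imp; intros m (H1 & H2); unfold a, r.
  assert (Hss : sqrt (INR (v m)) * sqrt (INR (v m)) = INR (v m)) by (apply sqrt_sqrt; lra).
  set (s := sqrt (INR (v m))) in *; rewrite <- Hss.
  replace (s * s - INR (u m) + INR i + 1) with
    (s * s * (1 - INR (u m) / s * / s + (INR i + 1) * (/ s * / s))) by (field; lra).
  replace ((INR (u m) - 1 - INR i) * (INR (u m) - INR i)) with
    (s * s * ((INR (u m) / s - (1 + INR i) * / s) * (INR (u m) / s - INR i * / s))) by (field; lra).
  generalize (1 - INR (u m) / s * / s + (INR i + 1) * (/ s * / s)); intros Y.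
  unfold Rdiv; rewrite !Rinv_mult; generalize (/ Y); intros y; field; lra.
- replace (c ^ 2 / (INR i + 1)) with
    ((c - (1 + INR i) * 0) * (c - INR i * 0) * / ((INR i + 1) * (1 - c * 0 + (INR i + 1) * (0 * 0))))
    by (field; lra).
  apply is_lim_seq_mult'.
  + apply is_lim_seq_mult'; apply is_lim_seq_minus'; auto;
      apply is_lim_seq_mult'; auto; apply is_lim_seq_const.
  + apply (is_lim_seq_inv _ (Finite _)).
    * apply is_lim_seq_mult'; [apply is_lim_seq_const|].
      apply is_lim_seq_plus'; [apply is_lim_seq_minus'|].
      -- apply is_lim_seq_const.
      -- now apply is_lim_seq_mult'.
      -- apply is_lim_seq_mult'; [apply is_lim_seq_const|now apply is_lim_seq_mult'].
    * intros E; injection E; lra.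
Qed.

(** Abstract weights let one statement serve both halves: [u] is the small parameter and [v] the
    large one, namely [k] and [n] for [S], but [n] and [k] for [S - k + n]. *)
Lemma hypergeometric_poisson (P : nat -> nat -> R) (u v : nat -> nat) (c : R) :
  0 <= c ->
  cv_infty (fun m => INR (v m)) ->
  Un_cv (fun m => INR (u m) / sqrt (INR (v m))) c ->
  (forall m i, 0 <= P m i) ->
  (forall m i, (u m < i)%nat -> P m i = 0) ->
  (forall m, (1 <= v m)%nat -> (u m <= v m)%nat ->
     sum_f_R0 (P m) (u m) = 1 /\
     (INR (v m) + INR (u m) - 1) * expect (P m) (u m) INR = INR (u m) * (INR (u m) - 1) /\
     forall i, P m (S i) * ((INR i + 1) * (INR (v m) - INR (u m) + INR i + 1)) =
       P m i * ((INR (u m) - 1 - INR i) * (INR (u m) - INR i))) ->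
  forall x, Un_cv (fun m => sum_f_R0 (fun j => if Rle_dec (INR j) x then P m j else 0) (u m))
    (cdf_poisson (c ^ 2) x).
Proof.
intros Hc Hv Hu HP HK H x.
apply cv_infty_lim in Hv; apply is_lim_seq_Reals in Hu.
apply is_lim_seq_Reals, poisson_cdf_limit; auto.
assert (Hev := eventually_sqrt_ratio_le u v c Hc Hv Hu).
assert (Hev' : forall m, 2 <= INR (v m) -> (1 <= v m)%nat) by (intros m Hm; apply INR_le; simpl; lra).
apply ratio_limit_poisson with (K := u) (B := 2 * (c + 1) ^ 2)
  (rho := fun m i => (INR (u m) - 1 - INR i) * (INR (u m) - INR i) /
     ((INR i + 1) * (INR (v m) - INR (u m) + INR i + 1))); auto.
- nra.
- revert Hev; apply filter_imp; intros m (H1 & H2 & H3).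
  now destruct (H m (Hev' m H1) H2).
- revert Hev; apply filter_imp; intros m (H1 & H2 & H3).
  destruct (H m (Hev' m H1) H2) as (_ & Hm & _).
  set (mu := expect _ _ _) in *; generalize (pos_INR (u m)); intros Hu0.
  assert (Hmu : 0 <= mu).
  { apply cond_pos_sum; intros; apply Rmult_le_pos; [apply HP|apply pos_INR]. }
  (* [v + u - 1 >= v / 2] because [v >= 2], and [u (u - 1) <= (c + 1) ^ 2 v]. *)
  assert (INR (v m) / 2 * mu <= (c + 1) ^ 2 * INR (v m)) by nra.
  apply Rmult_le_reg_l with (INR (v m) / 2); lra.
- revert Hev; apply filter_imp; intros m (H1 & H2 & H3) i.
  destruct (H m (Hev' m H1) H2) as (_ & _ & Hr).
  apply le_INR in H2; generalize (pos_INR i); intros Hi.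
  unfold Rdiv; rewrite <- Rmult_assoc, <- Hr; field; lra.
- intros i; now apply ratio_limit.
Qed.

(** Since [0 ^ 0 = 1], only the term [j = 0] survives. This makes the degenerate limits the case
    [c = 0] of the Poisson ones. *)
Lemma cdf_poisson_0 (x : R) : cdf_poisson 0 x = cdf_dirac0 x.
Proof.
unfold cdf_poisson, cdf_dirac0.
rewrite (sum_f_R0_trunc _ 0); [| |lia].
- simpl; rewrite Ropp_0, exp_0; destruct (Rle_dec 0 x); field.
- intros j Hj _; destruct (Rle_dec (INR j) x); auto.
  rewrite pow_i by lia; unfold Rdiv; ring.
Qed.

(** * Poisson limits for [S] and for [S - k + n] *)

Lemma pmf_S_lt (n k j : nat) : (j + n < k)%nat -> pmf_S n k j = 0.
Proof. intros H; unfold pmf_S; rewrite (binom_gt n) by lia; simpl; unfold Rdiv; ring. Qed.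

Lemma sum_f_R0_shift (f : nat -> R) (d n : nat) :
  (forall j, (j < d)%nat -> f j = 0) ->
  sum_f_R0 f (d + n) = sum_f_R0 (fun i => f (d + i)%nat) n.
Proof.
intros H; induction n as [|n IH].
- rewrite Nat.add_0_r; simpl; destruct d as [|d]; simpl; auto.
  rewrite sum_f_R0_0; [rewrite Nat.add_0_r; ring|intros; apply H; lia].
- rewrite Nat.add_succ_r; simpl; rewrite IH; do 2 f_equal; lia.
Qed.

(** For [n <= k] the law lives on [k - n, ..., k], so [i = j - (k - n)] runs over [0, ..., n]. *)
Lemma pmf_S_sum_shift (n k : nat) (g : nat -> R) : (n <= k)%nat ->
  sum_f_R0 (fun i => pmf_S n k (k - n + i) * g (k - n + i)%nat) n = expect (pmf_S n k) k g.
Proof.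
intros H; unfold expect.
rewrite <- (sum_f_R0_shift (fun j => pmf_S n k j * g j)).
- now replace (k - n + n)%nat with k by lia.
- intros j Hj; rewrite pmf_S_lt by lia; ring.
Qed.

Lemma conv_S_poisson (n k : nat -> nat) (c : R) : 0 <= c ->
  cv_infty (fun m => INR (n m)) ->
  Un_cv (fun m => INR (k m) / sqrt (INR (n m))) c ->
  forall x, Un_cv (fun m => cdf_of (n m) (k m) INR x) (cdf_poisson (c ^ 2) x).
Proof.
intros Hc Hn Hk x.
apply (hypergeometric_poisson (fun m => pmf_S (n m) (k m)) k n c); auto.
- intros; apply pmf_S_ge0.
- intros; now apply pmf_S_gt.
- intros m Hm _; repeat split.
  + now apply pmf_S_sum.
  + now rewrite <- mean_S_expect, mean_S_eq.
  + intros i; apply pmf_S_rec.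
Qed.

(** Under [j = k - n + i] the factors [k - 1 - j], [k - j], [j + 1], [n - k + j + 1] become
    [n - 1 - i], [n - i], [k - n + i + 1], [i + 1]: the recursion keeps its form with [n] and [k]
    exchanged. *)
Lemma conv_S_shift_poisson (n k : nat -> nat) (c : R) : 0 <= c ->
  (forall m, (1 <= n m)%nat) ->
  cv_infty (fun m => INR (k m)) ->
  Un_cv (fun m => INR (n m) / sqrt (INR (k m))) c ->
  forall x, Un_cv (fun m => cdf_of (n m) (k m) (fun j => INR j - INR (k m) + INR (n m)) x)
    (cdf_poisson (c ^ 2) x).
Proof.
intros Hc H1 Hk Hn x.
assert (Hsub : forall m i, (n m <= k m)%nat -> INR (k m - n m + i) = INR (k m) - INR (n m) + INR i)
  by (intros; rewrite plus_INR, minus_INR by lia; reflexivity).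
apply is_lim_seq_Reals.
apply is_lim_seq_ext_loc with (fun m =>
  sum_f_R0 (fun i => if Rle_dec (INR i) x then pmf_S (n m) (k m) (k m - n m + i) else 0) (n m)).
(* Eventually [n <= k], which makes the natural subtraction [k - n] exact. *)
- generalize (eventually_sqrt_ratio_le n k c Hc (cv_infty_lim _ Hk) (proj2 (is_lim_seq_Reals _ _) Hn)).
  apply filter_imp; intros m (_ & H & _); unfold cdf_of.
  transitivity (expect (pmf_S (n m) (k m)) (k m)
    (fun j => if Rle_dec (INR j - INR (k m) + INR (n m)) x then 1 else 0)).
  + rewrite <- pmf_S_sum_shift by assumption; apply sum_eq; intros i _; rewrite Hsub by assumption.
    replace (INR (k m) - INR (n m) + INR i - INR (k m) + INR (n m)) with (INR i) by ring.
    destruct (Rle_dec (INR i) x); ring.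
  + apply sum_eq; intros i _; destruct (Rle_dec _ x); ring.
- apply is_lim_seq_Reals.
  apply (hypergeometric_poisson (fun m i => pmf_S (n m) (k m) (k m - n m + i)) n k c); auto.
  + intros; apply pmf_S_ge0.
  + intros m i Hi; apply pmf_S_gt; lia.
  + intros m Hm H.
    assert (Hs := pmf_S_sum (n m) (k m) (H1 m)); repeat split.
    * rewrite <- (expect_const _ _ 1 Hs), <- pmf_S_sum_shift by assumption.
      apply sum_eq; intros; ring.
    * assert (Hmu := mean_S_eq (n m) (k m) (H1 m)).
      transitivity ((INR (n m) + INR (k m) - 1) * (mean_S (n m) (k m) - (INR (k m) - INR (n m)))).
      -- rewrite (Rplus_comm (INR (k m))); f_equal.
         transitivity (expect (pmf_S (n m) (k m)) (k m) (fun j => 1 * INR j + (- (INR (k m) - INR (n m))) * 1)).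
         ++ rewrite <- pmf_S_sum_shift by assumption; apply sum_eq; intros i _.
            rewrite Hsub by assumption; ring.
         ++ rewrite (expect_lin _ _ _ _ INR (fun _ => 1)), expect_const, <- mean_S_expect by assumption; ring.
      -- rewrite Rmult_minus_distr_l, Hmu; ring.
    * intros i; generalize (pmf_S_rec (n m) (k m) (k m - n m + i)).
      rewrite Hsub, Nat.add_succ_r by assumption; intros E.
      transitivity (pmf_S (n m) (k m) (S (k m - n m + i)) *
        ((INR (k m) - INR (n m) + INR i + 1) * (INR (n m) - INR (k m) + (INR (k m) - INR (n m) + INR i) + 1))); [ring|].
      rewrite E; ring.
Qed.

(** * The Gaussian integral *)

Definition gauss (t : R) : R := exp (- (t ^ 2) / 2).

Lemma is_derive_gauss (t : R) : is_derive gauss t (- t * gauss t).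
Proof. unfold gauss; auto_derive; [easy|].
replace (- (t * (t * 1)) * / 2) with (- t ^ 2 / 2) by field; field.
Qed. 

Lemma continuous_gauss (t : R) : continuous gauss t.
Proof. apply (ex_derive_continuous gauss); eexists; apply is_derive_gauss. Qed.

Lemma gauss_pos (t : R) : 0 < gauss t.
Proof. apply exp_pos. Qed.

Lemma gauss_le1 (t : R) : gauss t <= 1.
Proof.
unfold gauss; rewrite <- exp_0.
destruct (Req_dec (- (t ^ 2) / 2) 0) as [->|H]; [right; reflexivity|].
left; apply exp_increasing; nra.
Qed.

Lemma ex_RInt_cont (f : R -> R) (a b : R) : (forall t, continuous f t) -> ex_RInt f a b.
Proof. intros H; apply (ex_RInt_continuous (V := R_CompleteNormedModule)); auto. Qed.

Lemma is_derive_RInt_cont (f : R -> R) (a x : R) : (forall t, continuous f t) ->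
  is_derive (fun y => RInt f a y) x (f x).
Proof.
intros H; apply is_derive_RInt with a; auto.
apply filter_forall; intros y; apply RInt_correct; now apply ex_RInt_cont.
Qed.


(** The auxiliary integral of the classical evaluation of the Gaussian integral by differentiation
    under the integral sign. *)
Definition gauss_aux (x : R) : R := RInt (fun t => exp (- (x ^ 2 * (1 + t ^ 2)) / 2) / (1 + t ^ 2)) 0 1.


Lemma gauss_mul (x t : R) : exp (- (x ^ 2 * (1 + t ^ 2)) / 2) = gauss x * gauss (x * t).
Proof. unfold gauss; rewrite <- exp_plus; f_equal; field. Qed.

(** Differentiation in [x] cancels the denominator [1 + t ^ 2], and the substitution [s = x t] turns
    the integral of [x gauss (x t)] over [[0, 1]] into the primitive of [gauss] at [x]. *)
Lemma is_derive_gauss_aux (x : R) : is_derive gauss_aux x (- gauss x * RInt gauss 0 x).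
Proof.
(* The summand [+ 0] gives the argument the affine shape of [is_RInt_comp_lin]. *)
assert (Hd : forall y t, is_derive (fun u => exp (- (u ^ 2 * (1 + t ^ 2)) / 2) / (1 + t ^ 2)) y
   (- gauss y * (y * gauss (y * t + 0)))).
{ intros y t; rewrite Rplus_0_r.
  replace (- gauss y * (y * gauss (y * t))) with (- y * (gauss y * gauss (y * t))) by ring.
  rewrite <- gauss_mul; auto_derive; [nra|].
  replace (- (y * (y * 1) * (1 + t * (t * 1))) * / 2) with (- (y ^ 2 * (1 + t ^ 2)) / 2) by field.
  field; nra. }
assert (Hcg : forall y t, continuous (fun t => gauss (y * t + 0)) t).
{ intros y t; apply (continuous_comp (fun t => y * t + 0) gauss); [|apply continuous_gauss].
  apply (ex_derive_continuous (fun t => y * t + 0)); now auto_derive. }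
replace (- gauss x * RInt gauss 0 x) with
  (RInt (fun t => Derive (fun u => exp (- (u ^ 2 * (1 + t ^ 2)) / 2) / (1 + t ^ 2)) x) 0 1).
- apply (is_derive_RInt_param (fun u t => exp (- (u ^ 2 * (1 + t ^ 2)) / 2) / (1 + t ^ 2))).
  + apply filter_forall; intros y t _; eexists; apply Hd.
  + intros t _.
    apply continuity_2d_pt_ext with (fun u v => - gauss u * (u * gauss (u * v + 0))).
    { intros u v; symmetry; apply is_derive_unique, Hd. }
    assert (Hc : forall z, continuity_pt gauss z)
      by (intros z; apply continuity_pt_filterlim, continuous_gauss).
    apply continuity_2d_pt_mult; [|apply continuity_2d_pt_mult].
    * apply continuity_2d_pt_opp.
      apply (continuity_1d_2d_pt_comp gauss (fun u _ => u)); [apply Hc|apply continuity_2d_pt_id1].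
    * apply continuity_2d_pt_id1.
    * apply (continuity_1d_2d_pt_comp gauss (fun u v => u * v + 0)); [apply Hc|].
      apply continuity_2d_pt_plus; [|apply continuity_2d_pt_const].
      apply continuity_2d_pt_mult; [apply continuity_2d_pt_id1|apply continuity_2d_pt_id2].
  + apply filter_forall; intros y; apply ex_RInt_cont; intros t.
    apply (ex_derive_continuous (fun t => exp (- (y ^ 2 * (1 + t ^ 2)) / 2) / (1 + t ^ 2))).
    auto_derive; nra.
- apply is_RInt_unique.
  apply is_RInt_ext with (fun t => scal (- gauss x) (scal x (gauss (x * t + 0)))).
  { intros t _; symmetry; now apply is_derive_unique, Hd. }
  apply (is_RInt_scal (V := R_NormedModule) (fun t => scal x (gauss (x * t + 0))) 0 1 (- gauss x) (RInt gauss 0 x)).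
  apply (is_RInt_comp_lin (V := R_NormedModule) gauss x 0 0 1).
  rewrite Rmult_0_r, Rmult_1_r, !Rplus_0_r.
  apply (RInt_correct (V := R_CompleteNormedModule)), ex_RInt_cont, continuous_gauss.
Qed.

Lemma gauss_aux_le (x : R) : 0 <= gauss_aux x <= gauss x.
Proof.
assert (Hc : forall t, continuous (fun t => exp (- (x ^ 2 * (1 + t ^ 2)) / 2) / (1 + t ^ 2)) t).
{ intros t; apply (ex_derive_continuous (fun t => exp (- (x ^ 2 * (1 + t ^ 2)) / 2) / (1 + t ^ 2))).
  auto_derive; nra. }
assert (Hb : forall t, 0 <= exp (- (x ^ 2 * (1 + t ^ 2)) / 2) / (1 + t ^ 2) <= gauss x).
{ intros t; rewrite gauss_mul.
  generalize (gauss_pos x) (gauss_pos (x * t)) (gauss_le1 (x * t)); intros A B D.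
  assert (0 < / (1 + t ^ 2) <= 1).
  { split; [apply Rinv_0_lt_compat; nra|rewrite <- Rinv_1; apply Rinv_le_contravar; nra]. }
  unfold Rdiv; split; [apply Rmult_le_pos; nra|].
  assert (gauss x * gauss (x * t) <= gauss x) by nra.
  assert (0 <= gauss x * gauss (x * t)) by nra; nra. }
split.
- apply RInt_ge_0; [lra|now apply ex_RInt_cont|intros; apply Hb].
- replace (gauss x) with (RInt (fun _ => gauss x) 0 1).
  + apply RInt_le; [lra|now apply ex_RInt_cont|apply ex_RInt_const|intros; apply Hb].
  + rewrite RInt_const; unfold scal; simpl; unfold mult; simpl; ring.
Qed.

Lemma gauss_aux_0 : gauss_aux 0 = PI / 4.
Proof.
transitivity (atan 1 - atan 0); [|rewrite atan_1, atan_0; ring].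
apply is_RInt_unique.
apply is_RInt_ext with (fun t => / (1 + t ^ 2)).
- intros t _; rewrite gauss_mul, Rmult_0_l; unfold gauss.
  replace (- 0 ^ 2 / 2) with 0 by field; rewrite exp_0.
  change (/ (1 + t ^ 2) = 1 * 1 / (1 + t ^ 2)); field; nra.
- apply (is_RInt_derive atan (fun t => / (1 + t ^ 2))).
  + intros t _; apply is_derive_Reals, derivable_pt_lim_atan.
  + intros t _; apply (ex_derive_continuous (fun t => / (1 + t ^ 2))); auto_derive; nra.
Qed.

(* The derivative of [A ^ 2 + 2 * gauss_aux] vanishes, where [A] is the primitive of [gauss]. *)
Lemma gauss_primitive_sq (x : R) : RInt gauss 0 x ^ 2 + 2 * gauss_aux x = PI / 2.
Proof.
set (F := fun x => RInt gauss 0 x ^ 2 + 2 * gauss_aux x).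
assert (HF : forall x, is_derive F x 0).
{ intros y; unfold F.
  evar_last.
  - apply (is_derive_plus (V := R_NormedModule) (fun x => RInt gauss 0 x ^ 2) (fun x => 2 * gauss_aux x)).
    + apply is_derive_pow, is_derive_RInt_cont, continuous_gauss.
    + apply is_derive_scal, is_derive_gauss_aux.
  - change (INR 2 * gauss y * RInt gauss 0 y ^ 1 + 2 * (- gauss y * RInt gauss 0 y) = 0).
    simpl; ring. }
assert (E : F x = F 0).
{ destruct (MVT_gen F 0 x (fun _ => 0)) as (z & _ & Hz).
  - intros; apply HF.
  - intros y _; apply continuity_pt_filterlim, (ex_derive_continuous F); eexists; apply HF.
  - lra. }
change (F x = PI / 2); rewrite E; unfold F; rewrite gauss_aux_0, RInt_point.
change (@zero R_CompleteNormedModule) with 0; lra.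
Qed.

(** At nonnegative points the primitive is the square root of [PI / 2 - 2 * gauss_aux x], and
    [gauss_aux] tends to 0 because it is at most [gauss]. *)
Lemma gauss_primitive_lim : is_lim_seq (fun m => RInt gauss 0 (INR m)) (sqrt (PI / 2)).
Proof.
assert (Hg : is_lim_seq (fun m => gauss_aux (INR m)) 0).
{ apply is_lim_seq_le_le_loc with (fun _ => 0) (fun m => 2 * / (INR m)).
  - exists 1%nat; intros m Hm; apply le_INR in Hm; simpl in Hm.
    generalize (gauss_aux_le (INR m)); intros [H1 H2]; split; [lra|].
    apply Rle_trans with (1 := H2); unfold gauss.
    replace (- INR m ^ 2 / 2) with (- (INR m ^ 2 / 2)) by field; rewrite exp_Ropp.
    replace (2 * / INR m) with (/ (INR m / 2)) by (field; lra).
    apply Rinv_le_contravar; [lra|].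
    (* [m / 2 <= 1 + m ^ 2 / 2 <= exp (m ^ 2 / 2)]. *)
    generalize (exp_ineq1_le (INR m ^ 2 / 2)); nra.
  - apply is_lim_seq_const.
  - replace 0 with (2 * 0) by ring; apply is_lim_seq_mult'; [apply is_lim_seq_const|].
    apply (is_lim_seq_inv _ p_infty); [apply is_lim_seq_INR|easy]. }
apply is_lim_seq_ext with (fun m => sqrt (PI / 2 - 2 * gauss_aux (INR m))).
- intros m; rewrite <- (gauss_primitive_sq (INR m)).
  replace (_ - _) with (RInt gauss 0 (INR m) ^ 2) by ring.
  apply sqrt_pow2, RInt_ge_0; [apply pos_INR|apply ex_RInt_cont, continuous_gauss|].
  intros; apply Rlt_le, gauss_pos.
- apply is_lim_seq_continuous with (f := sqrt) (u := fun m => PI / 2 - 2 * gauss_aux (INR m)).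
  + apply continuity_pt_sqrt; generalize PI_RGT_0; lra.
  + replace (PI / 2) with (PI / 2 - 2 * 0) at 1 by ring.
    apply is_lim_seq_minus'; [apply is_lim_seq_const|].
    apply is_lim_seq_mult'; [apply is_lim_seq_const|exact Hg].
Qed.

(** Starting the integral at 0 avoids an improper one; [/ 2] is the mass of the negative half-line,
    which [norm_cdf_lim] and [norm_cdf_opp] confirm. *)
Definition norm_cdf (x : R) : R := / 2 + RInt std_normal_density 0 x.

Lemma std_normal_density_gauss (t : R) : std_normal_density t = / sqrt (2 * PI) * gauss t.
Proof. unfold std_normal_density, gauss, Rdiv; ring. Qed.

Lemma continuous_density (t : R) : continuous std_normal_density t.
Proof.
apply continuous_ext with (fun t => scal (/ sqrt (2 * PI)) (gauss t)).
- intros; symmetry; apply std_normal_density_gauss.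
- apply (continuous_scal_r (V := R_NormedModule) (/ sqrt (2 * PI)) gauss), continuous_gauss.
Qed.

Lemma density_pos (t : R) : 0 < std_normal_density t <= 1.
Proof.
rewrite std_normal_density_gauss; generalize PI2_3_2 (gauss_pos t) (gauss_le1 t); intros H H1 H2.
assert (1 <= sqrt (2 * PI)) by (rewrite <- sqrt_1; apply sqrt_le_1_alt; lra).
assert (0 < / sqrt (2 * PI) <= 1).
{ split; [apply Rinv_0_lt_compat; lra|rewrite <- Rinv_1; apply Rinv_le_contravar; lra]. }
nra.
Qed.

Lemma RInt_density_norm_cdf (a b : R) : RInt std_normal_density a b = norm_cdf b - norm_cdf a.
Proof.
unfold norm_cdf.
rewrite <- (RInt_Chasles std_normal_density a 0 b) by apply ex_RInt_cont, continuous_density.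
rewrite <- (opp_RInt_swap std_normal_density a 0) by apply ex_RInt_cont, continuous_density.
unfold plus, opp; simpl; ring.
Qed.

Lemma norm_cdf_mono (a b : R) : a <= b -> 0 <= norm_cdf b - norm_cdf a <= b - a.
Proof.
intros H; rewrite <- RInt_density_norm_cdf; split.
- apply RInt_ge_0; [lra|apply ex_RInt_cont, continuous_density|intros; apply Rlt_le, density_pos].
- replace (b - a) with (RInt (fun _ => 1) a b).
  + apply RInt_le; [lra|apply ex_RInt_cont, continuous_density|apply ex_RInt_const|intros; apply density_pos].
  + rewrite RInt_const; unfold scal; simpl; unfold mult; simpl; ring.
Qed.

Lemma norm_cdf_opp (x : R) : norm_cdf (- x) = 1 - norm_cdf x.
Proof.
unfold norm_cdf.
assert (H : RInt std_normal_density 0 (- x) = - RInt std_normal_density 0 x).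
{ apply is_RInt_unique.
  apply is_RInt_ext with (fun y => opp (opp (std_normal_density (- y)))).
  - intros y _; rewrite opp_opp; unfold std_normal_density; do 3 f_equal; ring.
  - apply (is_RInt_opp (V := R_NormedModule) (fun y => opp (std_normal_density (- y)))).
    apply (is_RInt_comp_opp (V := R_NormedModule)); rewrite Ropp_0, Ropp_involutive.
    apply (RInt_correct (V := R_CompleteNormedModule)), ex_RInt_cont, continuous_density. }
lra.
Qed.

Lemma norm_cdf_lim : is_lim_seq (fun m => norm_cdf (INR m)) 1.
Proof.
replace 1 with (/ 2 + / sqrt (2 * PI) * sqrt (PI / 2)).
- apply is_lim_seq_plus'; [apply is_lim_seq_const|].
  apply is_lim_seq_ext with (fun m => / sqrt (2 * PI) * RInt gauss 0 (INR m)).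
  + intros m; symmetry; apply is_RInt_unique.
    apply is_RInt_ext with (fun t => scal (/ sqrt (2 * PI)) (gauss t)).
    * intros; symmetry; apply std_normal_density_gauss.
    * apply (is_RInt_scal (V := R_NormedModule) gauss).
      apply (RInt_correct (V := R_CompleteNormedModule)), ex_RInt_cont, continuous_gauss.
  + apply is_lim_seq_mult'; [apply is_lim_seq_const|apply gauss_primitive_lim].
- generalize PI_RGT_0; intros HP.
  (* [sqrt (2 * PI)] is twice [sqrt (PI / 2)], so the half-line has mass [/ 2]. *)
  replace (2 * PI) with (2 ^ 2 * (PI / 2)) by field.
  rewrite sqrt_mult, sqrt_pow2 by lra; field.
  apply Rgt_not_eq, sqrt_lt_R0; lra.
Qed.

Lemma norm_cdf_le1 (x : R) : norm_cdf x <= 1.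
Proof.
apply (is_lim_seq_le_loc (fun _ => norm_cdf x) (fun m => norm_cdf (INR m)) (norm_cdf x) 1).
- destruct (nfloor_ex (Rmax 0 x) (Rmax_l _ _)) as [N [_ HN]]; exists (S N); intros m Hm.
  apply le_INR in Hm; rewrite S_INR in Hm; generalize (Rmax_r 0 x); intros Hx.
  generalize (norm_cdf_mono x (INR m) ltac:(lra)); lra.
- apply is_lim_seq_const.
- apply norm_cdf_lim.
Qed.

Lemma norm_cdf_tail (eps : R) : 0 < eps ->
  exists M0, forall M, M0 <= M -> 1 - eps < norm_cdf M /\ norm_cdf (- M) < eps.
Proof.
intros He; destruct (proj1 (is_lim_seq_Reals _ _) norm_cdf_lim eps He) as [N HN].
exists (INR N); intros M HM; specialize (HN N (le_n N)).
unfold R_dist in HN; apply Rabs_lt_between in HN.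
generalize (norm_cdf_mono (INR N) M HM); rewrite norm_cdf_opp; lra.
Qed.

(** The integral from [- M] to [x] differs from [norm_cdf x] by [norm_cdf (- M)], which is small for
    large [M]. *)
Lemma is_std_normal_cdf_at_norm_cdf (x : R) : is_std_normal_cdf_at x (norm_cdf x).
Proof.
intros eps He; destruct (norm_cdf_tail eps He) as [M0 H0].
exists M0; intros M HM pr; rewrite <- RInt_Reals, RInt_density_norm_cdf.
destruct (H0 M ltac:(lra)) as [_ H1].
generalize (norm_cdf_le1 M); rewrite norm_cdf_opp in *; intros H2.
apply Rabs_lt_between; lra.
Qed.

(** * Stein's method *)

Lemma compact_support_bounded (g : R -> R) (L : R) :
  (forall w, continuous g w) -> (forall w, L <= Rabs w -> g w = 0) ->
  exists B, forall w, Rabs (g w) <= B.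
Proof.
intros Hc H0.
destruct (Rle_lt_dec 0 L) as [HL|HL].
- destruct (continuity_ab_maj (fun w => Rabs (g w)) (- L) L) as (x & Hx & _); [lra| |].
  + intros c _; apply (continuity_pt_comp g Rabs); [|apply Rcontinuity_abs].
    apply continuity_pt_filterlim, Hc.
  + exists (Rabs (g x)); intros w; destruct (Rle_lt_dec L (Rabs w)) as [H|H].
    * rewrite (H0 w H), Rabs_R0; apply Rabs_pos.
    * apply Hx; apply Rabs_lt_between in H; lra.
- exists 0; intros w; rewrite H0, Rabs_R0; [lra|generalize (Rabs_pos w); lra].
Qed.

Lemma compact_support_unif_cont (g : R -> R) (L eps : R) : 0 < eps ->
  (forall w, continuous g w) -> (forall w, L <= Rabs w -> g w = 0) ->
  exists d, 0 < d /\ forall w w', Rabs (w - w') < d -> Rabs (g w - g w') <= eps.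
Proof.
intros He Hc H0.
(* The interval is enlarged by 1 and the modulus capped at 1, so that both points lie in it as soon
   as one of them is in [[-L, L]]. *)
destruct (Heine_cor2 (f := g) (a := - L - 1) (b := L + 1)
  ltac:(intros; apply continuity_pt_filterlim, Hc) (mkposreal eps He)) as [[d Hd] H]; simpl in H.
exists (Rmin d 1); split; [apply Rmin_pos; lra|]; intros w w' Hw.
assert (H1 := Rmin_l d 1); assert (H2 := Rmin_r d 1).
destruct (Rle_lt_dec L (Rabs w)) as [C|C]; destruct (Rle_lt_dec L (Rabs w')) as [C'|C'].
- rewrite !H0, Rminus_0_r, Rabs_R0 by assumption; lra.
- apply Rlt_le, H; [..|lra]; apply Rabs_lt_between in C'; apply Rabs_lt_between in Hw; lra.
- apply Rlt_le, H; [..|lra]; apply Rabs_lt_between in C; apply Rabs_lt_between in Hw; lra.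
- apply Rlt_le, H; [..|lra]; apply Rabs_lt_between in C'; apply Rabs_lt_between in C; lra.
Qed.

Lemma is_derive_density (t : R) : is_derive std_normal_density t (- t * std_normal_density t).
Proof.
apply is_derive_ext with (fun t => / sqrt (2 * PI) * gauss t).
- intros; symmetry; apply std_normal_density_gauss.
- rewrite std_normal_density_gauss.
  replace (- t * _) with (/ sqrt (2 * PI) * (- t * gauss t)) by ring.
  apply is_derive_scal, is_derive_gauss.
Qed.

Lemma continuous_mul_density (psi : R -> R) : (forall w, continuous psi w) ->
  forall w, continuous (fun t => psi t * std_normal_density t) w.
Proof. intros H w; apply (continuous_mult psi std_normal_density); [apply H|apply continuous_density]. Qed.

Lemma RInt_eq_0 (f : R -> R) (a b : R) :
  (forall t, Rmin a b < t < Rmax a b -> f t = 0) -> RInt f a b = 0.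
Proof.
intros H; apply is_RInt_unique, is_RInt_ext with (fun _ => 0).
- intros; symmetry; auto.
- evar_last; [apply (is_RInt_const (V := R_NormedModule))|].
  unfold scal; simpl; unfold mult; simpl; ring.
Qed.

(* The centring condition on [psi] makes [f] vanish outside [-L, L], so that the solution of
   the Stein equation has a compactly supported continuous derivative. *)
Lemma stein_solution (psi : R -> R) (L : R) : 0 < L ->
  (forall w, continuous psi w) -> (forall w, L <= Rabs w -> psi w = 0) ->
  RInt (fun t => psi t * std_normal_density t) (- L) L = 0 ->
  exists f f' : R -> R, (forall w, is_derive f w (f' w)) /\
    (forall w, f' w = w * f w + psi w) /\
    (forall w, continuous f' w) /\ (forall w, L <= Rabs w -> f' w = 0).
Proof.
intros HL Hc H0 Hint.
set (h := fun t => psi t * std_normal_density t) in *.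
assert (Hh : forall w, continuous h w) by now apply continuous_mul_density.
(* The density has derivative [- w] times itself, so it acts as an integrating factor for
   [f' = w f + psi]. *)
set (f := fun w => RInt h (- L) w * / std_normal_density w).
assert (Hd : forall w, is_derive f w (w * f w + psi w)).
{ intros w; unfold f; generalize (density_pos w); intros Hw.
  evar_last.
  - apply (is_derive_mult (K := R_AbsRing) (RInt h (- L)) (fun w => / std_normal_density w) w _ _
      (is_derive_RInt_cont h (- L) w Hh)
      (is_derive_inv _ _ _ (is_derive_density w) (Rgt_not_eq _ _ (proj1 Hw))) Rmult_comm).
  - unfold plus, mult, h; simpl; unfold mult; simpl; field; lra. }
exists f, (fun w => w * f w + psi w); split; [exact Hd|split; [reflexivity|split]].
- intros w; apply (continuous_plus (fun w => w * f w) psi); [|apply Hc].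
  apply (continuous_mult (fun w => w) f); [apply continuous_id|].
  apply (ex_derive_continuous f); eexists; apply Hd.
- intros w Hw; rewrite H0 by assumption.
  (* Right of [L] the integral is the full one, which is zero; left of [- L] the integrand
     vanishes. *)
  enough (E : RInt h (- L) w = 0) by (unfold f; rewrite E; ring).
  assert (Hz : forall t, L <= Rabs t -> h t = 0) by (intros t Ht; unfold h; rewrite H0; auto; ring).
  destruct (Rle_lt_dec 0 w) as [C|C].
  + rewrite Rabs_pos_eq in Hw by assumption.
    rewrite <- (RInt_Chasles h (- L) L w), Hint by now apply ex_RInt_cont.
    rewrite (RInt_eq_0 h L w).
    * unfold plus; simpl; ring.
    * intros t; rewrite Rmin_left, Rmax_right by assumption; intros Ht; apply Hz; rewrite Rabs_pos_eq; lra.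
  + rewrite Rabs_left in Hw by assumption.
    apply RInt_eq_0; intros t; rewrite Rmin_right, Rmax_left by lra; intros Ht.
    apply Hz; rewrite Rabs_left; lra.
Qed.

(** With [s] the standard deviation, [T] scaled to mean 1 and [D] the difference quotient of [f]
    with step [/ s], the Stein identity reads [E (T D) = E (W f (W - / s))]. Adding this null
    difference leaves three errors: [f' (W) - D], at most [om]; [D (1 - T)], controlled by the
    concentration of [T]; and [W D / s], of mean at most [B / s]. *)
Lemma stein_bound (n k : nat) (f f' : R -> R) (B om : R) :
  let W j := (INR j - mean_S n k) / sqrt (var_S n k) in
  (2 <= n)%nat -> (2 <= k)%nat -> 0 < var_S n k ->
  (forall w, is_derive f w (f' w)) ->
  (forall w, Rabs (f' w) <= B) ->
  (forall w w', Rabs (w - w') <= / sqrt (var_S n k) -> Rabs (f' w - f' w') <= om) ->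
  Rabs (expect (pmf_S n k) k (fun j => f' (W j) - W j * f (W j))) <=
  om + B * (3 / sqrt (var_S n k) + 2 / INR n).
Proof.
intros W Hn Hk Hv Hf HB Hom.
assert (Hn1 : (1 <= n)%nat) by lia.
assert (Hsum := pmf_S_sum n k Hn1).
assert (Hp := pmf_S_ge0 n k).
assert (Hst := pmf_S_stein n k (fun y => f ((y - mean_S n k) / sqrt (var_S n k))) Hn1).
assert (Hss : sqrt (var_S n k) * sqrt (var_S n k) = var_S n k) by (apply sqrt_sqrt; lra).
assert (Hs0 : 0 < sqrt (var_S n k)) by now apply sqrt_lt_R0.
assert (HE2 := var_S_expect n k).
assert (Hq := var_S_quad n k Hn1); destruct (mean_S_compl n k Hn1) as [Ha Hb].
rewrite <- Hss in Hq, HE2.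
apply le_INR in Hn, Hk; simpl in Hn, Hk.
set (mu := mean_S n k) in *; set (s := sqrt (var_S n k)) in *.
set (N := INR n + INR k - 1) in *.
set (E := expect (pmf_S n k) k) in *.
set (T := fun j => (INR k - INR j) * (INR k - 1 - INR j) / (N * (s * s))).
set (D := fun j => s * (f (W j) - f (W j - / s))).
assert (HN : 3 <= N) by (unfold N; lra).
assert (HW1 : forall j, (INR j - 1 - mu) / s = W j - / s) by (intros; unfold W; field; lra).
(* By the mean value theorem [D j] is a value of [f'] within [/ s] of [W j]. *)
assert (HD : forall j, exists xi, W j - / s <= xi <= W j /\ D j = f' xi).
{ intros j; assert (0 < / s) by now apply Rinv_0_lt_compat.
  destruct (MVT_gen f (W j - / s) (W j) f') as (xi & Hxi & E1).
  - intros; apply Hf.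
  - intros y _; apply continuity_pt_filterlim, (ex_derive_continuous f); eexists; apply Hf.
  - rewrite Rmin_left, Rmax_right in Hxi by lra.
    exists xi; split; [assumption|]; unfold D; rewrite E1; field; lra. }
assert (HE2' : E (fun j => W j ^ 2) = 1).
{ transitivity (E (fun j => / (s * s) * (INR j - mu) ^ 2 + 0 * 0)).
  - apply expect_ext; intros; unfold W; field; lra.
  - unfold E; rewrite (expect_lin _ _ (/ (s * s)) 0 _ (fun _ => 0)); fold E; rewrite <- HE2; field; lra. }
assert (HEW : E (fun j => Rabs (W j)) <= 1).
(* [|y| <= (1 + y ^ 2) / 2] takes the place of Cauchy-Schwarz. *)
{ apply Rle_trans with (E (fun j => / 2 * 1 + / 2 * W j ^ 2)).
  - apply expect_le; [assumption|]; intros j _; rewrite <- (pow2_abs (W j)).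
    generalize (Rabs (W j)); intros y; generalize (pow2_ge_0 (y - 1)); lra.
  - unfold E; rewrite (expect_lin _ _ (/ 2) (/ 2) (fun _ => 1)), expect_const by assumption.
    fold E; rewrite HE2'; lra. }
assert (HT : forall j, Rabs (1 - T j) <= 2 / s * Rabs (W j) + / N * (W j ^ 2 + 1)).
{ intros j.
  (* [- c] is the slope at [mu] of the quadratic in [T]; [N c = k n + (k - 1) (n - 1)] is at most
     [2 N ^ 2]. *)
  set (c := 2 * INR k - 1 - 2 * mu).
  assert (Hc : 0 <= c <= 2 * N).
  { assert (Hc1 : N * c = INR k * INR n + (INR k - 1) * (INR n - 1)) by (unfold c; lra).
    split; apply Rmult_le_reg_l with N; [lra|rewrite Hc1; nra|lra|rewrite Hc1; unfold N; nra]. }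
  replace (1 - T j) with (c / N * (/ s * W j) + - (/ N * W j ^ 2) + / N).
  - apply Rle_trans with (1 := Rabs_triang _ _).
    assert (Rabs (c / N * (/ s * W j)) <= 2 * (/ s * Rabs (W j))).
    { rewrite !Rabs_mult, (Rabs_pos_eq (/ s)) by (apply Rlt_le, Rinv_0_lt_compat; lra).
      apply Rmult_le_compat_r.
      - apply Rmult_le_pos; [apply Rlt_le, Rinv_0_lt_compat; lra|apply Rabs_pos].
      - rewrite Rabs_pos_eq; [apply Rle_div_l; lra|apply Rdiv_le_0_compat; lra]. }
    assert (0 < / N) by (apply Rinv_0_lt_compat; lra).
    assert (Rabs (- (/ N * W j ^ 2)) = / N * W j ^ 2).
    { rewrite Rabs_Ropp, Rabs_pos_eq; [reflexivity|]; apply Rmult_le_pos; [lra|apply pow2_ge_0]. }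
    generalize (Rabs_triang (c / N * (/ s * W j)) (- (/ N * W j ^ 2))).
    rewrite (Rabs_pos_eq (/ N)) by lra; unfold Rdiv; lra.
  - unfold T; replace ((INR k - INR j) * (INR k - 1 - INR j)) with
      ((N - 1) * (s * s) - c * (INR j - mu) + (INR j - mu) ^ 2).
    + unfold W; field; lra.
    + replace (N - 1) with (INR n + INR k - 2) by (unfold N; ring); rewrite Hq; unfold c; ring. }
assert (HET : E (fun j => Rabs (1 - T j)) <= 2 / s + 2 / N).
{ apply Rle_trans with (E (fun j => 2 / s * Rabs (W j) + / N * (1 * W j ^ 2 + 1 * 1))).
  - apply expect_le; [assumption|]; intros j _; generalize (HT j); lra.
  - unfold E; rewrite (expect_lin _ _ (2 / s)), (expect_lin _ _ 1 1 _ (fun _ => 1)), expect_const by assumption.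
    fold E; rewrite HE2'.
    assert (0 < / s) by (apply Rinv_0_lt_compat; lra); unfold Rdiv; nra. }
assert (HS : E (fun j => T j * D j) = E (fun j => W j * f (W j - / s))).
{ transitivity (/ (N * s) * E (fun j => (INR k - INR j) * (INR k - 1 - INR j) *
     (f ((INR j - mu) / s) - f ((INR j - 1 - mu) / s)))).
  - transitivity (/ (N * s) * E (fun j => (INR k - INR j) * (INR k - 1 - INR j) *
     (f ((INR j - mu) / s) - f ((INR j - 1 - mu) / s))) + 0 * E (fun _ => 0)); [|ring].
    unfold E; rewrite <- expect_lin; apply expect_ext; intros j _; rewrite HW1.
    unfold T, D; fold (W j); field; lra.
  - rewrite <- Hst.
    transitivity (/ s * E (fun j => (INR j - mu) * f ((INR j - 1 - mu) / s)) + 0 * E (fun _ => 0)).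
    + field; lra.
    + unfold E; rewrite <- expect_lin; apply expect_ext; intros j _; rewrite HW1.
      unfold W; field; lra. }
assert (HB0 : 0 <= B) by (apply Rle_trans with (2 := HB 0), Rabs_pos).
apply Rle_trans with (om * 1 + B * (1 * (2 / s + 2 / N) + / s * 1)).
2:{ assert (/ N <= / INR n) by (apply Rinv_le_contravar; unfold N; lra).
    unfold Rdiv; nra. }
(* The added bracket has expectation 0 by [HS]. *)
replace (E (fun j => f' (W j) - W j * f (W j))) with
  (E (fun j => 1 * (f' (W j) - W j * f (W j)) + 1 * (1 * (W j * f (W j - / s)) + -1 * (T j * D j)))).
2:{ unfold E; rewrite expect_lin, (expect_lin _ _ 1 (-1)); fold E; rewrite HS; ring. }
apply Rle_trans with (1 := expect_abs _ _ _ Hp).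
apply Rle_trans with (E (fun j => om * 1 + B * (1 * Rabs (1 - T j) + / s * Rabs (W j)))).
- apply expect_le; [assumption|]; intros j _; destruct (HD j) as (xi & Hxi & HDj).
  replace (1 * _ + _) with ((f' (W j) - f' xi) + (f' xi * (1 - T j) + - (W j * (D j * / s)))).
  2:{ rewrite <- HDj; unfold D; field; lra. }
  apply Rle_trans with (1 := Rabs_triang _ _); apply Rplus_le_compat.
  + rewrite Rmult_1_r; apply Hom, Rabs_le; assert (0 < / s) by now apply Rinv_0_lt_compat.
    lra.
  + apply Rle_trans with (1 := Rabs_triang _ _); rewrite Rabs_Ropp, HDj, !Rabs_mult.
    rewrite (Rabs_pos_eq (/ s)) by (apply Rlt_le, Rinv_0_lt_compat; lra).
    rewrite Rmult_1_l, Rmult_plus_distr_l; apply Rplus_le_compat.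
    * apply Rmult_le_compat_r; [apply Rabs_pos|apply HB].
    * replace (Rabs (W j) * _) with (Rabs (f' xi) * (/ s * Rabs (W j))) by ring.
      apply Rmult_le_compat_r; [|apply HB].
      apply Rmult_le_pos; [apply Rlt_le, Rinv_0_lt_compat; lra|apply Rabs_pos].
- unfold E; rewrite (expect_lin _ _ om B (fun _ => 1)), (expect_lin _ _ 1 (/ s)), expect_const by assumption.
  fold E; apply Rplus_le_compat_l, Rmult_le_compat_l; [assumption|].
  assert (0 < / s) by now apply Rinv_0_lt_compat.
  apply Rplus_le_compat; apply Rmult_le_compat_l; lra.
Qed.

Lemma eventually_lt_inv (s : nat -> R) (C eps : R) : is_lim_seq s p_infty -> 0 < eps ->
  eventually (fun m => C / s m < eps).
Proof.
intros Hs He.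
assert (H : is_lim_seq (fun m => C * / s m) (C * 0)).
{ apply is_lim_seq_mult'; [apply is_lim_seq_const|now apply (is_lim_seq_inv _ p_infty)]. }
generalize (eventually_near _ _ eps H He); apply filter_imp; intros m Hm.
apply Rabs_lt_between in Hm; unfold Rdiv; lra.
Qed.

(** The Stein equation writes [psi] as [f' - w f]. The bound is small once [/ s] is below the
    modulus of uniform continuity of [f'] and both [s] and [n] are large. *)
Lemma stein_limit (n k : nat -> nat) (psi : R -> R) (L : R) :
  is_lim_seq (fun m => INR (n m)) p_infty ->
  is_lim_seq (fun m => INR (k m)) p_infty ->
  is_lim_seq (fun m => sqrt (var_S (n m) (k m))) p_infty ->
  0 < L -> (forall w, continuous psi w) -> (forall w, L <= Rabs w -> psi w = 0) ->
  RInt (fun t => psi t * std_normal_density t) (- L) L = 0 ->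
  is_lim_seq (fun m => expect (pmf_S (n m) (k m)) (k m)
    (fun j => psi ((INR j - mean_S (n m) (k m)) / sqrt (var_S (n m) (k m))))) 0.
Proof.
intros Hn Hk Hs HL Hc H0 Hint.
destruct (stein_solution psi L HL Hc H0 Hint) as (f & f' & Hf & Hf' & Hcf & H0f).
destruct (compact_support_bounded f' L Hcf H0f) as [B HB].
apply is_lim_seq_spec; intros [e He]; simpl.
destruct (compact_support_unif_cont f' L (e / 4) ltac:(lra) Hcf H0f) as (d & Hd & Hu).
assert (He4 : 0 < e / 4) by lra.
generalize (filter_and _ _ (eventually_gt _ 1 Hn) (filter_and _ _ (eventually_gt _ 1 Hk)
  (filter_and _ _ (eventually_gt _ 0 Hs) (filter_and _ _ (eventually_lt_inv _ 1 d Hs Hd)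
  (filter_and _ _ (eventually_lt_inv _ (B * 3) (e / 4) Hs He4) (eventually_lt_inv _ (B * 2) (e / 4) Hn He4)))))).
apply filter_imp; intros m (A1 & A2 & A3 & A4 & A5 & A6).
assert (B1 : (2 <= n m)%nat) by (apply (INR_lt 1) in A1; lia).
assert (B2 : (2 <= k m)%nat) by (apply (INR_lt 1) in A2; lia).
assert (Hv : 0 < var_S (n m) (k m)).
(* [sqrt] is 0 at nonpositive arguments, so a positive root forces a positive variance. *)
{ apply Rnot_le_lt; intros C; rewrite sqrt_neg_0 in A3 by assumption; lra. }
generalize (stein_bound (n m) (k m) f f' B (e / 4) B1 B2 Hv Hf HB); cbv zeta; intros H.
rewrite Rminus_0_r.
rewrite (expect_ext _ _ _ (fun j =>
  f' ((INR j - mean_S (n m) (k m)) / sqrt (var_S (n m) (k m))) -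
  (INR j - mean_S (n m) (k m)) / sqrt (var_S (n m) (k m)) *
  f ((INR j - mean_S (n m) (k m)) / sqrt (var_S (n m) (k m))))).
2:{ intros j _; rewrite Hf'; ring. }
apply Rle_lt_trans with (e / 4 + B * (3 / sqrt (var_S (n m) (k m)) + 2 / INR (n m))).
- apply H; intros w w' Hw; apply Hu; unfold Rdiv in A4; lra.
- unfold Rdiv in *; lra.
Qed.

(** * The normal limit *)

(** The truncation of [t] to [[0, 1]], written with absolute values so that continuity is
    immediate. *)
Definition ramp (t : R) : R := (1 + Rabs t - Rabs (1 - t)) / 2.

Lemma ramp_spec (t : R) : 0 <= ramp t <= 1 /\ (t <= 0 -> ramp t = 0) /\ (1 <= t -> ramp t = 1).
Proof.
unfold ramp, Rabs; destruct (Rcase_abs t), (Rcase_abs (1 - t)); repeat split; intros; lra.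
Qed.

Lemma continuous_ramp (t : R) : continuous ramp t.
Proof.
unfold ramp; apply continuous_ext with (fun t => scal (/ 2) (minus (plus 1 (Rabs t)) (Rabs (1 - t)))).
- intros x; unfold scal, minus, plus, opp; simpl; unfold mult; simpl; field.
- apply (continuous_scal_r (V := R_NormedModule)), (continuous_minus (V := R_NormedModule)).
  + apply (continuous_plus (V := R_NormedModule)); [apply continuous_const|apply continuous_Rabs].
  + apply (continuous_comp (fun t => 1 - t) Rabs); [|apply continuous_Rabs].
    apply (ex_derive_continuous (fun t => 1 - t)); now auto_derive.
Qed.

Definition trapezoid (a b d w : R) : R := ramp ((w - a) / d) * ramp ((b - w) / d).

Lemma continuous_trapezoid (a b d w : R) : continuous (trapezoid a b d) w.
Proof.
apply (continuous_mult (fun w => ramp ((w - a) / d)) (fun w => ramp ((b - w) / d))).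
- apply (continuous_comp (fun w => (w - a) / d) ramp); [|apply continuous_ramp].
  apply (ex_derive_continuous (fun w => (w - a) / d)); now auto_derive.
- apply (continuous_comp (fun w => (b - w) / d) ramp); [|apply continuous_ramp].
  apply (ex_derive_continuous (fun w => (b - w) / d)); now auto_derive.
Qed.

Lemma trapezoid_bounds (a b d w : R) : 0 <= trapezoid a b d w <= 1.
Proof.
unfold trapezoid; destruct (ramp_spec ((w - a) / d)) as [H1 _], (ramp_spec ((b - w) / d)) as [H2 _]; nra.
Qed.

Lemma trapezoid_out (a b d w : R) : 0 < d -> w <= a \/ b <= w -> trapezoid a b d w = 0.
Proof.
intros Hd [H|H]; unfold trapezoid.
- rewrite (proj1 (proj2 (ramp_spec ((w - a) / d)))); [ring|apply Rle_div_l; lra].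
- rewrite (proj1 (proj2 (ramp_spec ((b - w) / d)))); [ring|apply Rle_div_l; lra].
Qed.

Lemma trapezoid_in (a b d w : R) : 0 < d -> a + d <= w <= b - d -> trapezoid a b d w = 1.
Proof.
intros Hd H; unfold trapezoid.
rewrite (proj2 (proj2 (ramp_spec ((w - a) / d)))) by (apply Rle_div_r; lra).
rewrite (proj2 (proj2 (ramp_spec ((b - w) / d)))) by (apply Rle_div_r; lra); ring.
Qed.

Lemma RInt_trapezoid (a b d L : R) : 0 < d -> a + d <= b - d -> - L <= a -> b <= L ->
  norm_cdf (b - d) - norm_cdf (a + d) <=
  RInt (fun t => trapezoid a b d t * std_normal_density t) (- L) L <= 1.
Proof.
intros Hd Hab Ha Hb.
set (h := fun t => trapezoid a b d t * std_normal_density t).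
assert (Hh : forall t, continuous h t) by (apply continuous_mul_density, continuous_trapezoid).
assert (H0 : forall t, 0 <= h t <= std_normal_density t).
{ intros t; unfold h; generalize (trapezoid_bounds a b d t) (density_pos t); intros; nra. }
split.
- rewrite <- RInt_density_norm_cdf.
  rewrite <- (RInt_Chasles h (- L) (a + d) L), <- (RInt_Chasles h (a + d) (b - d) L)
    by now apply ex_RInt_cont.
  assert (0 <= RInt h (- L) (a + d)) by (apply RInt_ge_0; [lra|now apply ex_RInt_cont|intros; apply H0]).
  assert (0 <= RInt h (b - d) L) by (apply RInt_ge_0; [lra|now apply ex_RInt_cont|intros; apply H0]).
  rewrite (RInt_ext h std_normal_density (a + d) (b - d)).
  + unfold plus; simpl; lra.
  + intros t; rewrite Rmin_left, Rmax_right by lra; intros Ht; unfold h.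
    rewrite trapezoid_in by lra; apply Rmult_1_l.
- apply Rle_trans with (RInt std_normal_density (- L) L).
  + apply RInt_le; [lra|now apply ex_RInt_cont|apply ex_RInt_cont, continuous_density|intros; apply H0].
  + rewrite RInt_density_norm_cdf, norm_cdf_opp.
    generalize (norm_cdf_le1 L) (norm_cdf_le1 (- L)); rewrite norm_cdf_opp; lra.
Qed.

(** Only tests of Gaussian mean 0 are available, so the multiple [I / J] of a wide plateau [chi] is
    subtracted from the trapezoid. Chebyshev makes [E (chi W)] close to 1, and [J <= 1], so the
    trapezoid has mean at least about [I]. *)
Lemma test_lower_bound (P : nat -> nat -> R) (K : nat -> nat) (W : nat -> nat -> R) (a b d eps : R) :
  (forall m j, 0 <= P m j) -> (forall m, sum_f_R0 (P m) (K m) = 1) ->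
  eventually (fun m => expect (P m) (K m) (fun j => W m j ^ 2) = 1) ->
  (forall psi L, 0 < L -> (forall w, continuous psi w) -> (forall w, L <= Rabs w -> psi w = 0) ->
     RInt (fun t => psi t * std_normal_density t) (- L) L = 0 ->
     is_lim_seq (fun m => expect (P m) (K m) (fun j => psi (W m j))) 0) ->
  0 < d -> a + d <= b - d -> 0 < eps ->
  eventually (fun m => norm_cdf (b - d) - norm_cdf (a + d) - eps <=
    expect (P m) (K m) (fun j => trapezoid a b d (W m j))).
Proof.
intros HP H1 H2 Htest Hd Hab He.
destruct (norm_cdf_tail (/ 4) ltac:(lra)) as [M0 HM0].
destruct (nfloor_ex (2 / eps)) as [N0 [_ HN0]]; [apply Rdiv_le_0_compat; lra|].
(* [M >= M0] makes [J] positive; [M > 2 / eps] and [M >= 1] make the Chebyshev error at most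
   [eps / 2]. *)
set (M := Rmax M0 (INR N0 + 1)).
assert (HM1 : M0 <= M) by apply Rmax_l.
assert (HM2 : 2 / eps < M /\ 1 <= M).
{ generalize (Rmax_r M0 (INR N0 + 1)) (pos_INR N0); fold M; lra. }
assert (HM3 : / (M * M) <= eps / 2).
{ replace (eps / 2) with (/ (2 / eps)) by (field; lra).
  assert (0 < 2 / eps) by (apply Rdiv_lt_0_compat; lra).
  apply Rinv_le_contravar; nra. }
set (L := Rmax (M + 1) (Rmax (- a) b)).
assert (HL : M + 1 <= L /\ - a <= L /\ b <= L).
{ generalize (Rmax_l (M + 1) (Rmax (- a) b)) (Rmax_r (M + 1) (Rmax (- a) b))
    (Rmax_l (- a) b) (Rmax_r (- a) b); fold L; lra. }
set (chi := trapezoid (- (M + 1)) (M + 1) 1).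
destruct (RInt_trapezoid a b d L Hd Hab ltac:(lra) ltac:(lra)) as [I1 I2].
destruct (RInt_trapezoid (- (M + 1)) (M + 1) 1 L ltac:(lra) ltac:(lra) ltac:(lra) ltac:(lra)) as [J1 J2].
fold chi in J1, J2.
replace (M + 1 - 1) with M in J1 by ring; replace (- (M + 1) + 1) with (- M) in J1 by ring.
set (I := RInt (fun t => trapezoid a b d t * std_normal_density t) (- L) L) in *.
set (J := RInt (fun t => chi t * std_normal_density t) (- L) L) in *.
assert (HJ : 0 < J) by (generalize (HM0 M HM1); lra).
assert (HI : 0 <= I) by (generalize (norm_cdf_mono (a + d) (b - d) Hab); lra).
set (psi := fun w => trapezoid a b d w - I / J * chi w).
assert (Hpc : forall w, continuous psi w).
{ intros w; apply (continuous_minus (V := R_NormedModule) (trapezoid a b d) (fun w => I / J * chi w)).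
  - apply continuous_trapezoid.
  - apply (continuous_scal_r (V := R_NormedModule) (I / J) chi), continuous_trapezoid. }
assert (Hp0 : forall w, L <= Rabs w -> psi w = 0).
{ intros w Hw; assert (Hw' : w <= - L \/ L <= w) by (revert Hw; unfold Rabs; destruct (Rcase_abs w); lra).
  unfold psi, chi; rewrite !trapezoid_out by lra; ring. }
assert (Hpi : RInt (fun t => psi t * std_normal_density t) (- L) L = 0).
{ apply is_RInt_unique.
  apply is_RInt_ext with (fun t => minus (trapezoid a b d t * std_normal_density t)
     (scal (I / J) (chi t * std_normal_density t))).
  - intros t _; unfold psi, minus, plus, opp, scal; simpl; unfold mult; simpl; ring.
  - evar_last.
    + apply (is_RInt_minus (V := R_NormedModule)); [|apply (is_RInt_scal (V := R_NormedModule))];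
        apply (RInt_correct (V := R_CompleteNormedModule)), ex_RInt_cont, continuous_mul_density;
        apply continuous_trapezoid.
    + fold I J; unfold minus, plus, opp, scal; simpl; unfold mult; simpl; field; lra. }
assert (He2 : 0 < eps / 2) by lra.
generalize (filter_and _ _ H2 (eventually_near _ _ (eps / 2) (Htest psi L ltac:(lra) Hpc Hp0 Hpi) He2)).
apply filter_imp; intros m [A1 A2].
set (E := expect (P m) (K m)) in *.
(* Pointwise, [chi w] is at least [1 - w ^ 2 / M ^ 2]. *)
assert (Echi : 1 - / (M * M) <= E (fun j => chi (W m j))).
{ replace (1 - / (M * M)) with (E (fun j => 1 * 1 + - / (M * M) * W m j ^ 2)).
  2:{ unfold E; rewrite (expect_lin _ _ 1 _ (fun _ => 1)), expect_const by apply H1; fold E.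
      rewrite A1; ring. }
  apply expect_le; [apply HP|]; intros j _; generalize (W m j); intros w.
  assert (0 < / (M * M)) by (apply Rinv_0_lt_compat; nra).
  destruct (Rle_lt_dec (Rabs w) M) as [C|C].
  - apply Rabs_le_between in C; unfold chi; rewrite trapezoid_in by lra.
    generalize (pow2_ge_0 w); nra.
  - assert (1 <= / (M * M) * w ^ 2).
    { apply Rmult_le_reg_l with (M * M); [nra|].
      rewrite <- pow2_abs; field_simplify; [|lra]; generalize (Rabs w) C; intros y Hy; nra. }
    generalize (trapezoid_bounds (- (M + 1)) (M + 1) 1 w); fold chi; unfold chi; lra. }
assert (Epsi : E (fun j => trapezoid a b d (W m j)) =
   1 * E (fun j => psi (W m j)) + I / J * E (fun j => chi (W m j))).
{ unfold E; rewrite <- expect_lin; apply expect_ext; intros; unfold psi; ring. }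
rewrite Epsi; rewrite Rminus_0_r in A2; apply Rabs_lt_between in A2.
assert (I <= I / J).
{ apply Rle_div_r; [assumption|]; nra. }
assert (HMM : / (M * M) <= 1) by (rewrite <- Rinv_1; apply Rinv_le_contravar; nra).
assert (I * (1 - / (M * M)) <= I / J * E (fun j => chi (W m j))) by (apply Rmult_le_compat; lra).
assert (0 < / (M * M)) by (apply Rinv_0_lt_compat; nra).
nra.
Qed.

(** Lower bounds suffice: a trapezoid left of [x] bounds the distribution function from below, and
    one right of [x] bounds its complement from below. *)
Lemma clt_of_test (P : nat -> nat -> R) (K : nat -> nat) (W : nat -> nat -> R) (x : R) :
  (forall m j, 0 <= P m j) -> (forall m, sum_f_R0 (P m) (K m) = 1) ->
  eventually (fun m => expect (P m) (K m) (fun j => W m j ^ 2) = 1) ->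
  (forall psi L, 0 < L -> (forall w, continuous psi w) -> (forall w, L <= Rabs w -> psi w = 0) ->
     RInt (fun t => psi t * std_normal_density t) (- L) L = 0 ->
     is_lim_seq (fun m => expect (P m) (K m) (fun j => psi (W m j))) 0) ->
  is_lim_seq (fun m => sum_f_R0 (fun j => if Rle_dec (W m j) x then P m j else 0) (K m)) (norm_cdf x).
Proof.
intros HP H1 H2 Htest.
apply is_lim_seq_spec; intros [e He]; simpl.
assert (He4 : 0 < e / 4) by lra.
destruct (norm_cdf_tail (e / 4) He4) as [M0 HM0].
set (M := Rmax M0 (Rabs x + 1 + e)).
assert (HM1 : M0 <= M) by apply Rmax_l.
assert (HM2 : Rabs x + 1 + e <= M) by apply Rmax_r.
generalize (Rle_abs x) (Rle_abs (- x)); rewrite Rabs_Ropp; intros Hx1 Hx2.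
set (d := e / 4) in *.
(* Each side loses at most [e / 4] for the slope at [x], for the test and for the Gaussian tail. *)
assert (T1 := test_lower_bound P K W (- M - d) x d d HP H1 H2 Htest He4 ltac:(unfold d in *; lra) He4).
assert (T2 := test_lower_bound P K W x (M + d) d d HP H1 H2 Htest He4 ltac:(unfold d in *; lra) He4).
generalize (filter_and _ _ T1 T2); apply filter_imp; intros m [A1 A2].
replace (- M - d + d) with (- M) in A1 by ring; replace (M + d - d) with M in A2 by ring.
set (F := sum_f_R0 _ _).
assert (HF : F = expect (P m) (K m) (fun j => if Rle_dec (W m j) x then 1 else 0)).
{ apply sum_eq; intros j _; destruct (Rle_dec (W m j) x); ring. }
assert (U1 : expect (P m) (K m) (fun j => trapezoid (- M - d) x d (W m j)) <= F).
{ rewrite HF; apply expect_le; [apply HP|]; intros j _; destruct (Rle_dec (W m j) x).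
  - apply trapezoid_bounds.
  - rewrite trapezoid_out; lra. }
assert (U2 : expect (P m) (K m) (fun j => trapezoid x (M + d) d (W m j)) <= 1 - F).
{ replace (1 - F) with (1 * expect (P m) (K m) (fun _ => 1) + -1 * F)
    by (rewrite expect_const by apply H1; ring).
  rewrite HF, <- expect_lin; apply expect_le; [apply HP|]; intros j _; destruct (Rle_dec (W m j) x).
  - rewrite trapezoid_out; lra.
  - generalize (trapezoid_bounds x (M + d) d (W m j)); lra. }
destruct (HM0 M HM1) as [Q1 Q2].
generalize (norm_cdf_mono (x - d) x ltac:(lra)) (norm_cdf_mono x (x + d) ltac:(lra)); intros Q3 Q4.
apply Rabs_lt_between; unfold d in *; lra.
Qed.

(** Large [k / sqrt n] yields the first inequality of [var_S_ge], small [k / n ^ 2] the second. *)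
Lemma var_S_lim (n k : nat -> nat) :
  is_lim_seq (fun m => INR (n m)) p_infty ->
  is_lim_seq (fun m => INR (k m)) p_infty ->
  is_lim_seq (fun m => INR (k m) / sqrt (INR (n m))) p_infty ->
  is_lim_seq (fun m => INR (k m) / INR (n m) ^ 2) 0 ->
  is_lim_seq (fun m => var_S (n m) (k m)) p_infty.
Proof.
intros Hn Hk H1 H2; apply is_lim_seq_spec; intros V'; simpl.
(* [V >= 1] gives [(32 V) ^ 2 >= 32 V], used for the first inequality. *)
set (V := Rmax V' 0 + 1).
assert (HV : V' < V /\ 1 <= V) by (generalize (Rmax_l V' 0) (Rmax_r V' 0); unfold V; lra).
assert (H0 : 0 < / (32 * V)) by (apply Rinv_0_lt_compat; lra).
generalize (filter_and _ _ (eventually_gt _ 1 Hn) (filter_and _ _ (eventually_gt _ 1 Hk)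
  (filter_and _ _ (eventually_gt _ (32 * V) H1) (eventually_near _ _ _ H2 H0)))).
apply filter_imp; intros m (A1 & A2 & A3 & A4).
apply Rlt_le_trans with (1 := proj1 HV), var_S_ge.
- apply (INR_lt 1) in A1; lia.
- apply (INR_lt 1) in A2; lia.
- assert (Hs : 0 < sqrt (INR (n m))) by (apply sqrt_lt_R0; lra).
  assert (Hss := sqrt_sqrt (INR (n m)) ltac:(lra)).
  apply Rlt_div_r in A3; [|assumption].
  rewrite <- Hss; set (s := sqrt (INR (n m))) in *.
  apply Rle_trans with ((32 * V * s) ^ 2); [|apply pow_incr; nra].
  assert (0 < s * s) by nra; nra.
- rewrite Rminus_0_r in A4; apply Rabs_lt_between in A4; destruct A4 as [_ A4].
  apply Rlt_div_l in A4; [|nra].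
  apply Rmult_le_reg_l with (/ (32 * V)); [assumption|]; field_simplify; [|lra|lra].
  apply Rlt_le, Rlt_le_trans with (1 := A4), Req_le; field; lra.
Qed.

(** * The five limit laws *)

Theorem mainTheorem12 :
  (* (1a) *)
  (forall n k : nat -> nat,
     (forall m, (1 <= n m)%nat) ->
     cv_infty (fun m => INR (n m)) ->
     Un_cv (fun m => INR (k m) / sqrt (INR (n m))) 0 ->
     conv_in_dist (fun m => cdf_of (n m) (k m) INR) cdf_dirac0) /\
  (* (1b) *)
  (forall n k : nat -> nat,
     (forall m, (1 <= n m)%nat) ->
     cv_infty (fun m => INR (k m)) ->
     Un_cv (fun m => INR (n m) / sqrt (INR (k m))) 0 ->
     conv_in_dist (fun m => cdf_of (n m) (k m) (fun j => INR j - INR (k m) + INR (n m)))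
                  cdf_dirac0) /\
  (* (2a) *)
  (forall (n k : nat -> nat) (c : R),
     c > 0 ->
     (forall m, (1 <= n m)%nat) ->
     cv_infty (fun m => INR (n m)) ->
     cv_infty (fun m => INR (k m)) ->
     Un_cv (fun m => INR (k m) / sqrt (INR (n m))) c ->
     conv_in_dist (fun m => cdf_of (n m) (k m) INR) (cdf_poisson (c ^ 2))) /\
  (* (2b) *)
  (forall (n k : nat -> nat) (c : R),
     c > 0 ->
     (forall m, (1 <= n m)%nat) ->
     cv_infty (fun m => INR (n m)) ->
     cv_infty (fun m => INR (k m)) ->
     Un_cv (fun m => INR (n m) / sqrt (INR (k m))) c ->
     conv_in_dist (fun m => cdf_of (n m) (k m) (fun j => INR j - INR (k m) + INR (n m)))
                  (cdf_poisson (c ^ 2))) /\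
  (* (3) *)
  (forall n k : nat -> nat,
     (forall m, (1 <= n m)%nat) ->
     cv_infty (fun m => INR (n m)) ->
     cv_infty (fun m => INR (k m)) ->
     cv_infty (fun m => INR (k m) / sqrt (INR (n m))) ->
     Un_cv (fun m => INR (k m) / INR (n m) ^ 2) 0 ->
     forall x : R, exists l : R, is_std_normal_cdf_at x l /\
       Un_cv (fun m => cdf_of (n m) (k m)
                (fun j => (INR j - mean_S (n m) (k m)) / sqrt (var_S (n m) (k m))) x) l).
Proof.
assert (H00 : 0 ^ 2 = 0) by ring.
repeat split.
- intros n k H1 Hn Hk x _; rewrite <- cdf_poisson_0, <- H00; apply conv_S_poisson; auto; lra.
- intros n k H1 Hn Hk x _; rewrite <- cdf_poisson_0, <- H00; apply conv_S_shift_poisson; auto; lra.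
- intros n k c Hc H1 Hn Hk Hr x _; apply conv_S_poisson; auto; lra.
- intros n k c Hc H1 Hn Hk Hr x _; apply conv_S_shift_poisson; auto; lra.
- intros n k H1 Hn Hk H2 H3 x; exists (norm_cdf x); split; [apply is_std_normal_cdf_at_norm_cdf|].
  apply cv_infty_lim in Hn, Hk, H2; apply is_lim_seq_Reals in H3.
  assert (Hv := var_S_lim n k Hn Hk H2 H3).
  apply is_lim_seq_Reals.
  apply (clt_of_test (fun m => pmf_S (n m) (k m)) k
    (fun m j => (INR j - mean_S (n m) (k m)) / sqrt (var_S (n m) (k m)))).
  + intros; apply pmf_S_ge0.
  + intros; now apply pmf_S_sum.
  (* The standardised variable has second moment 1 once the variance is positive, which holds
     eventually. *)
  + generalize (eventually_gt _ 0 Hv); apply filter_imp; intros m Hm.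
    transitivity (/ var_S (n m) (k m) * var_S (n m) (k m) + 0 * expect (pmf_S (n m) (k m)) (k m) (fun _ => 0));
      [|field; lra].
    rewrite (var_S_expect (n m) (k m)) at 2; rewrite <- expect_lin; apply expect_ext; intros j _.
    assert (Hs := sqrt_lt_R0 _ Hm); unfold Rdiv; rewrite Rpow_mult_distr, pow_inv, pow2_sqrt by lra; ring.
  + intros psi L HL Hc H0 Hi; apply stein_limit with L; auto.
    exact (filterlim_comp _ _ _ _ _ _ _ _ Hv filterlim_sqrt_p).
Qed.
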